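(* The Tutte polynomial is a valuative invariant that is valuatively universal within the class of elementary split matroids.
   Context: $\mathsf{U}_{r,m}$ denotes the uniform matroid of rank $r$ on $m$ elements. A matroid is elementary split if it has no minor isomorphic to $\mathsf{U}_{0,1}\oplus\mathsf{U}_{1,2}\oplus\mathsf{U}_{1,1}$. For a finite set $E$, $\mathcal{M}_{E,k}$ is the set of matroids on $E$ of rank $k$; $\mathcal{M}_{n,k}=\mathcal{M}_{[n],k}$ and $\mathcal{M}=\bigsqcup_{0\le k\le n}\mathcal{M}_{n,k}$. The base polytope $\mathscr{P}(\mathsf{M})\subseteq\mathbb{R}^E$ is the convex hull of the indicator vectors of the bases. For an abelian group $A$, a map $f:\mathcal{M}_{E,k}\to A$ is valuative if $\sum_i a_i f(\mathsf{M}_i)=0$ whenever $a_i\in\mathbb{Z}$ and $\sum_i a_i\mathbb{1}_{\mathscr{P}(\mathsf{M}_i)}\equiv 0$ on $\mathbb{R}^E$. A valuative invariant is a map $f:\mathcal{M}\to A$ which is valuative on each $\mathcal{M}_{n,k}$ and isomorphism-invariant. For a class $\mathcal{C}\subseteq\mathcal{M}$, $\mathcal{C}_{n,k}=\mathcal{C}\cap\mathcal{M}_{n,k}$. A valuative invariant $u:\mathcal{M}\to A$ is valuatively universal within $\mathcal{C}$ if for every valuative invariant $f:\mathcal{M}\to A'$ and every $0\le k\le n$ there is a homomorphism $\widehat f_{n,k}:A\to A'$ with $f(\mathsf{M})=\widehat f_{n,k}(u(\mathsf{M}))$ for all $\mathsf{M}\in\mathcal{C}_{n,k}$. The Tutte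 polynomial is viewed as the map $T:\mathcal{M}\to\mathbb{Z}[x,y]$. *)

(* Defs.v *)
From HB Require Import structures.
From mathcomp Require Import all_boot all_order all_algebra all_fingroup.
From mathcomp Require Import boolp Rstruct.
From Stdlib Require Import Rdefinitions.

Set Implicit Arguments.
Unset Strict Implicit.
Unset Printing Implicit Defensive.

Import Order.TTheory GRing.Theory Num.Theory.
Local Open Scope ring_scope.

Definition basis_exchange (n : nat) (bs : {set {set 'I_n}}) : bool :=
  [forall B1 in bs, forall B2 in bs, forall x in B1 :\: B2,
     exists y in B2 :\: B1, (y |: (B1 :\ x)) \in bs].

Record matroid (n : nat) := Matroid {
  bases : {set {set 'I_n}};
  bases_nonempty : bases != set0;
  bases_exchange : basis_exchange bases
}.

Definition rk_of (T : finType) (bs : {set {set T}}) (X : {set T}) : nat :=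
  \max_(B in bs) #|X :&: B|.

Definition rk (n : nat) (M : matroid n) (X : {set 'I_n}) : nat :=
  rk_of (bases M) X.

Definition mrank (n : nat) (M : matroid n) : nat := rk M setT.

Definition misom (n : nat) (M M' : matroid n) : Prop :=
  exists s : {perm 'I_n}, bases M' = [set [set s i | i in B] | B : {set 'I_n} in bases M].

(* Minors.  M has a minor isomorphic to the matroid N (on 'I_m, given  *)
(* by its bases bN) iff there are C (contracted set) and an injection  *)
(* g : 'I_m -> 'I_n with image S disjoint from C (everything outside   *)
(* S ∪ C is deleted) such that r_N(X) = r_M(g X ∪ C) - r_M(C).          *)

Definition has_minor_iso (n m : nat) (M : matroid n) (bN : {set {set 'I_m}})
  : Prop :=
  exists (C : {set 'I_n}) (g : 'I_m -> 'I_n),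
    injective g /\ [disjoint (g @: setT) & C] /\
    forall X : {set 'I_m}, rk_of bN X = subn (rk M (g @: X :|: C)) (rk M C).

(* U_{0,1} ⊕ U_{1,2} ⊕ U_{1,1} on {0,1,2,3}: 0 is a loop, {1,2} is a
   parallel pair, 3 is a coloop; bases {1,3} and {2,3}. *)
Definition U01_U12_U11_bases : {set {set 'I_4}} :=
  [set [set (inord 1 : 'I_4); inord 3]; [set (inord 2 : 'I_4); inord 3]].

Definition elementary_split (n : nat) (M : matroid n) : Prop :=
  ~ has_minor_iso M U01_U12_U11_bases.

Definition in_base_polytope (n : nat) (M : matroid n) (x : 'I_n -> R) : Prop :=
  exists lam : {set 'I_n} -> R,
    (forall B, 0 <= lam B) /\
    \sum_(B in bases M) lam B = 1 /\
    forall i, x i = \sum_(B in bases M) lam B * (i \in B)%:R.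

Definition ind_base_polytope (n : nat) (M : matroid n) (x : 'I_n -> R) : int :=
  (asbool (in_base_polytope M x))%:R.

Definition valuative_on (A : zmodType) (n k : nat) (f : matroid n -> A) : Prop :=
  forall s : seq (int * matroid n),
    all (fun p => mrank p.2 == k) s ->
    (forall x : 'I_n -> R, \sum_(p <- s) p.1 * ind_base_polytope p.2 x = 0) ->
    \sum_(p <- s) f p.2 *~ p.1 = 0.

Definition valuative_invariant (A : zmodType) (f : forall n, matroid n -> A)
  : Prop :=
  (forall (n k : nat), leq k n -> valuative_on k (f n)) /\
  (forall n (M M' : matroid n), misom M M' -> f n M = f n M').

Definition valuatively_universal_within
  (A : zmodType) (u : forall n, matroid n -> A)
  (C : forall n, matroid n -> Prop) : Prop :=
  forall (A' : zmodType) (f : forall n, matroid n -> A'),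
    valuative_invariant f ->
    forall (n k : nat), leq k n ->
      exists h : {additive A -> A'},
        forall M : matroid n, C n M -> mrank M = k -> f n M = h (u n M).

(* Tutte polynomial in Z[x,y] = {poly {poly int}}, x = ('X)%:P, y = 'X.  *)

Definition tutte (n : nat) (M : matroid n) : {poly {poly int}} :=
  \sum_(X : {set 'I_n})
     ((('X : {poly int})%:P - 1) ^+ (subn (rk M setT) (rk M X))
      * ('X - 1) ^+ (subn #|X| (rk M X))).

(* Main.v *)
From Stdlib Require Import Rdefinitions.
From HB Require Import structures.
From mathcomp Require Import boolp classical_sets topology normedtype derive.
From mathcomp Require Import reals Rstruct.
From mathcomp Require Import all_boot all_order all_algebra all_fingroup.
From mathcomp Require Import zify ring lra.
Require Import Defs.

(** Valuativity: [P(M)] is the set of [x >= 0] with [x(S) <= rk S] for all [S]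
    and [x(E) = rk E], so [rk X >= j] says that the polytope [P(M)] meets the
    half-space [x(X) >= j].  The Euler characteristic sends the indicator of
    every nonempty polytope to 1 and is linear, hence [M |-> [rk X >= j]] is
    valuative, and the Tutte polynomial is a sum over [X] of functions of
    [rk X].

    Universality: if [M] is elementary split of rank [k], then two distinct
    cyclic flats [F], [G] that are dependent and not spanning satisfy
    [|F :&: G| + k <= rk F + rk G].  So the parts [x(F) > rk F] of the
    hypersimplex are disjoint, and [P(M)] is what remains after removing them.
    A valuative invariant of [M] is thus determined by the numbers of such flats
    of given rank and size.  These numbers depend linearly, through an integer
    unitriangular system, on the numbers of sets [X] of given rank and size,
    which are the coefficients of the Tutte polynomial at [x + 1], [y + 1]. *)

Set Implicit Arguments.
Unset Strict Implicit.
Unset Printing Implicit Defensive.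

Import numFieldNormedType.Exports.
Import Order.TTheory GRing.Theory Num.Theory.
Local Open Scope ring_scope.

(** * Euler characteristic of polytopes *)

Section EulerCharacteristic.
Variables (K : realType) (n : nat).

Definition in_cube (x : 'I_n -> K) : bool := [forall i, 0 <= x i <= 1].

Definition halfspace (c : ('I_n -> K) * K) (x : 'I_n -> K) : bool :=
  \sum_i c.1 i * x i <= c.2.

Definition in_box (sys : seq (('I_n -> K) * K)) (x : 'I_n -> K) : bool :=
  in_cube x && all (halfspace^~ x) sys.

(** Points are functions, so the cube is a product of segments and Tychonoff's theorem gives its
    compactness. *)
Let cube_space : topologicalType :=
  prod_topology (fun _ : 'I_n => (K : topologicalType)).

Lemma linear_form_continuous (c : 'I_n -> K) :
  continuous ((fun x => \sum_i c i * x i) : cube_space -> K).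
Proof.
have proj i : continuous ((fun x => x i) : cube_space -> K).
  exact: (@proj_continuous _ (fun _ : 'I_n => (K : topologicalType))).
move=> x; apply: (@cvg_big K 'I_n +%R 0 predT (@add_continuous K) cube_space
  (nbhs x) _ (fun i x => c i * x i) (fun i => c i * x i)) => i _.
by apply: cvgM; [exact: cvg_cst | exact: proj].
Qed.

Lemma box_compact (sys : seq (('I_n -> K) * K)) :
  compact (in_box sys : set cube_space).
Proof.
have closed_halfspace c : topology_structure.closed (halfspace c : set cube_space).
  apply: (@preimage_closed cube_space K (fun x => \sum_i c.1 i * x i) _ _
    (@num_normedtype.closed_le K c.2)) => x _.
  exact: linear_form_continuous.
elim: sys => [|c sys IHsys].
  have := @tychonoff 'I_n (fun=> K) _ (fun=> @segment_compact K 0 1).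
  congr compact; apply/seteqP; split=> x /=.
    move=> x01; rewrite /in_box andbT; apply/forallP => i.
    by have := x01 i; rewrite in_itv.
  by rewrite /in_box andbT => /forallP x01 i; have := x01 i; rewrite in_itv.
have := compact_closedI IHsys (closed_halfspace c).
congr compact; apply/seteqP; split=> x /=; rewrite /in_box /=.
  by move=> [/andP[-> ->] ->].
by move=> /and3P[-> -> ->].
Qed.


Lemma box_min sys (c : 'I_n -> K) : (exists x, in_box sys x) ->
  exists2 x, in_box sys x & forall y, in_box sys y ->
    \sum_i c i * x i <= \sum_i c i * y i.
Proof.
move=> box0.
have [|x xP xmin] := @compact_EVT_min cube_space K
  (fun x => \sum_i c i * x i) (in_box sys) box0 (@box_compact sys).
  exact/continuous_subspaceT/linear_form_continuous.
by exists x => [|y yP]; [exact: set_mem xP | exact/xmin/mem_set].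
Qed.

Lemma sum_pick (F : 'I_n -> K) i : \sum_j (j == i)%:R * F j = F i.
Proof.
rewrite (bigD1 i) //= eqxx mul1r big1 ?addr0 // => j /negPf->.
by rewrite mul0r.
Qed.

Lemma sum_pickN (F : 'I_n -> K) i : \sum_j - (j == i)%:R * F j = - F i.
Proof.
by rewrite -[in RHS](sum_pick F i) -sumrN; apply: eq_bigr => j _; rewrite mulNr.
Qed.

(** The endpoints are the extreme values of coordinate [i], attained by compactness; convex
    combinations of the two extremal points realize every value in between. *)
Lemma box_segment sys i : (exists x, in_box sys x) ->
  exists lu : K * K, forall t,
    (exists2 x, in_box sys x & x i = t) <-> lu.1 <= t <= lu.2.
Proof.
move=> box0.
have [l lP lmin] := box_min (fun j => (j == i)%:R) box0.
have [u uP umax] := box_min (fun j => - (j == i)%:R) box0.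
exists (l i, u i) => t; split=> [[x xP <-]|/andP[lt tu]] /=.
  have := lmin _ xP; rewrite !sum_pick => ->.
  by have := umax _ xP; rewrite !sum_pickN lerN2.
have [ul|lu] := leP (u i) (l i).
  by exists l => //; apply/le_anti; rewrite lt (le_trans tu ul).
pose w := (t - l i) / (u i - l i).
have lu0 : 0 < u i - l i by rewrite subr_gt0.
have w0 : 0 <= w by rewrite divr_ge0 ?subr_ge0 // ltW.
have w1 : 0 <= 1 - w.
  by rewrite subr_ge0 ler_pdivrMr // mul1r lerD2r.
have wE : w * (u i - l i) = t - l i by rewrite divfK // gt_eqF.
clearbody w.
exists (fun j => (1 - w) * l j + w * u j); last first.
  have -> : (1 - w) * l i + w * u i = l i + w * (u i - l i) by ring.
  by rewrite wE addrC subrK.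
move: lP uP; rewrite /in_box => /andP[/forallP lc lh] /andP[/forallP uc uh].
apply/andP; split.
  apply/forallP => j; move: (lc j) (uc j) => /andP[l0 l1] /andP[u0 u1].
  rewrite addr_ge0 ?mulr_ge0 //=.
  by rewrite -[leRHS](subrK w) lerD // ler_piMr.
elim: (sys) lh uh => //= h s IHs /andP[h1 lh] /andP[h2 uh].
apply/andP; split; last exact: IHs.
move: h1 h2; rewrite /halfspace => h1 h2.
have -> : \sum_j h.1 j * ((1 - w) * l j + w * u j) =
    (1 - w) * (\sum_j h.1 j * l j) + w * \sum_j h.1 j * u j.
  rewrite !mulr_sumr -big_split; apply: eq_bigr => j _ /=; ring.
have -> : h.2 = (1 - w) * h.2 + w * h.2 by ring.
by rewrite lerD // ler_wpM2l.
Qed.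

(** Provides a point left of [t] that is close enough for no endpoint of a given finite family to
    lie between it and [t]. *)
Lemma lt_gap (s : seq K) t :
  exists2 t', t' < t & forall p, p \in s -> p < t -> p < t'.
Proof.
elim: s => [|q s [t' t't IH]]; first by exists (t - 1) => //; lra.
have [qt|tq] := ltP q t; last first.
  exists t' => // p; rewrite inE => /orP[/eqP->|]; last exact: IH.
  by rewrite ltNge tq.
exists ((Num.max q t' + t) / 2%:R).
  by rewrite /Num.max; case: ifP => _; lra.
move=> p; rewrite inE => /orP[/eqP->|ps] pt.
  by rewrite /Num.max; case: ifP => ?; lra.
have := IH _ ps pt; rewrite /Num.max; case: ifP => ?; lra.
Qed.

(* The indicator of a segment jumps only at its left endpoint when seen from
   the left of a point close enough, so the coefficients of the segments with
   a given left endpoint sum to 0. *)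
Lemma euler_segments (J : finType) (a : J -> int) (D : J -> K -> Prop) :
    (forall j, (exists t, D j t) ->
       exists lu : K * K, forall t, D j t <-> lu.1 <= t <= lu.2) ->
    (forall t, \sum_j a j * (asbool (D j t))%:R = 0) ->
  \sum_j a j * (asbool (exists t, D j t))%:R = 0.
Proof.
move=> segD sum0.
have /choice[lu luP] : forall j, exists lu : K * K, (exists t, D j t) ->
    forall t, D j t <-> lu.1 <= t <= lu.2.
  move=> j; have [/segD[lu luP]|nD] := pselect (exists t, D j t).
    by exists lu.
  by exists (0, 0) => /nD.
pose ne j := `[< exists t, D j t >].
have jump t : \sum_j a j * (ne j && ((lu j).1 == t))%:R = 0.
  have [t' t't gap] := lt_gap (codom (fst \o lu) ++ codom (snd \o lu)) t.
  transitivity (\sum_j a j * (asbool (D j t))%:R -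
    \sum_j a j * (asbool (D j t'))%:R); last by rewrite !sum0 subrr.
  rewrite -sumrB; apply: eq_bigr => j _; rewrite -mulrBr; congr (_ * _).
  have lgap : (lu j).1 < t -> (lu j).1 < t'.
    by apply: gap; rewrite mem_cat (codom_f (fst \o lu)).
  have ugap : (lu j).2 < t -> (lu j).2 < t'.
    by apply: gap; rewrite mem_cat (codom_f (snd \o lu)) orbT.
  rewrite /ne; case: asboolP => [Dj|nD] /=; last first.
    by rewrite !asboolF ?subrr // => Dt; apply: nD; [exists t'|exists t].
  have lule : (lu j).1 <= (lu j).2.
    have [t0 Dt0] := Dj; have /andP[l0 u0] := (luP _ Dj _).1 Dt0.
    exact: le_trans l0 u0.
  have DE s : asbool (D j s) = ((lu j).1 <= s <= (lu j).2).
    by apply/asboolP/idP; apply luP.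
  rewrite !DE; case: (ltgtP (lu j).1 t) => [lt|tl|lt].
  - have lt' := lgap lt; rewrite (ltW lt') /=.
    case: (leP t (lu j).2) => [tu|/ugap ut']; first by rewrite (le_trans (ltW t't) tu).
    by rewrite (leNgt t') ut' /= subrr.
  - by rewrite (leNgt _ t') (lt_trans t't tl) /= subrr.
  - by rewrite -lt lule (leNgt _ t') lt t't subr0.
(* Summing the jumps over the distinct left endpoints counts every nonempty segment exactly once. *)
transitivity (\sum_(t <- undup (codom (fst \o lu)))
    \sum_j a j * (ne j && ((lu j).1 == t))%:R); last first.
  by apply: big1 => t _; exact: jump.
rewrite exchange_big; apply: eq_bigr => j _ /=.
rewrite (bigD1_seq (lu j).1) ?undup_uniq ?mem_undup ?(codom_f (fst \o lu)) //=.
rewrite eqxx andbT big1 ?addr0 // => t /negPf.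
by rewrite eq_sym => ->; rewrite andbF mulr0.
Qed.

(** Induction on the number [m] of free coordinates of a slice. The values of the first free
    coordinate on a nonempty slice form a segment, and fixing one of them leaves a slice with one
    free coordinate fewer, so [euler_segments] applies. *)
Lemma euler_boxes (J : finType) (a : J -> int)
    (sys : J -> seq (('I_n -> K) * K)) :
    (forall x, \sum_j a j * (in_box (sys j) x)%:R = 0) ->
  \sum_j a j * (asbool (exists x, in_box (sys j) x))%:R = 0.
Proof.
move=> sum0.
pose slice m (z : 'I_n -> K) j x :=
  in_box (sys j) x /\ forall i : 'I_n, (i < m)%N -> x i = z i.
have slices m z : (m <= n)%N ->
    \sum_j a j * (asbool (exists x, slice (n - m)%N z j x))%:R = 0.
  elim: m z => [|m IHm] z lemn.
    rewrite -[RHS](sum0 z) subn0; apply: eq_bigr => j _; congr (_ * (nat_of_bool _)%:R).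
    apply/asboolP/idP => [[x [xP xz]]|zP]; last by exists z.
    by congr in_box: xP; apply/funext => i; apply: xz.
  have lt_i : (n - m.+1 < n)%N by lia.
  pose i0 := Ordinal lt_i.
  pose D j t := exists2 x, slice (n - m.+1)%N z j x & x i0 = t.
  transitivity (\sum_j a j * (asbool (exists t, D j t))%:R).
    apply: eq_bigr => j _; congr (_ * (nat_of_bool _)%:R).
    apply: asbool_equiv_eq; split=> [[x xP]|[t [x xP _]]]; last by exists x.
    by exists (x i0), x.
  apply: euler_segments => [j [t [x [xP xz] _]]|t].
    (* Each equation [x i = z i] becomes two opposite half-spaces, so that a slice is again a
       box. *)
    pose fix_coord (i : 'I_n) : seq (('I_n -> K) * K) :=
      [:: ((fun j => (j == i)%:R), z i); ((fun j => - (j == i)%:R), - z i)].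
    have fixE i y : all (halfspace^~ y) (fix_coord i) = (y i == z i).
      rewrite /= andbT /halfspace /= sum_pick sum_pickN lerN2.
      by rewrite -eq_le.
    pose sysz := flatten [seq fix_coord i | i : 'I_n <- enum 'I_n & (i < n - m.+1)%N]
      ++ sys j.
    have inE y : in_box sysz y <-> slice (n - m.+1)%N z j y.
      rewrite /slice /in_box all_cat.
      have -> : all (halfspace^~ y) (flatten [seq fix_coord i | i : 'I_n <- enum 'I_n &
          (i < n - m.+1)%N]) =
          [forall i : 'I_n, (i < n - m.+1)%N ==> (y i == z i)].
        transitivity (all (fun i : 'I_n => (i < n - m.+1)%N ==> (y i == z i))
            (enum 'I_n)).
          elim: (enum 'I_n) => //= i s IHs; case: (i < _)%N => //=.
          by rewrite -fixE -IHs /= andbT andbA.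
        by apply/allP/forallP => yz i *; apply: yz; rewrite ?mem_enum.
      split=> [/and3P[-> /forallP yz ->]|[/andP[-> ->] yz]].
        by split=> // i ile; have := yz i; rewrite ile /= => /eqP.
      by rewrite andbT; apply/forallP => i; apply/implyP => /yz ->.
    have [|lu luP] := @box_segment sysz i0; first by exists x; apply/inE.
    exists lu => s; rewrite -luP; split=> -[y yP <-]; exists y => //.
      exact/inE.
    exact/inE.
  pose z' (i : 'I_n) := if i == i0 then t else z i.
  rewrite -[RHS](IHm z' (ltnW lemn)); apply: eq_bigr => j _; congr (_ * (nat_of_bool _)%:R).
  apply/asboolP/asboolP => [[x [xP xz] xt]|[x [xP xz]]].
    exists x; split=> // i ile; rewrite /z'; case: eqP => [->//|/eqP ni].
    apply: xz; have : (i : nat) != (n - m.+1)%N by [].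
    lia.
  exists x; last by rewrite xz /z' ?eqxx //=; lia.
  split=> // i ile; rewrite xz /z'; last by lia.
  by case: eqP => // ii; move: ile; rewrite ii /= ltnn.
have := slices n (fun=> 0) (leqnn n); rewrite subnn.
congr (_ = _); apply: eq_bigr => j _; congr (_ * (nat_of_bool _)%:R).
by apply/asboolP/asboolP => -[x] => [[]|]; exists x.
Qed.

End EulerCharacteristic.

(** * Rank function *)

Section Rank.
Variables (n : nat) (M : matroid n).
Implicit Types (B C X Y S : {set 'I_n}).
Local Open Scope nat_scope.

Lemma ex_max_set (P : pred {set 'I_n}) (F : {set 'I_n} -> nat) B0 : P B0 ->
  exists2 B, P B & forall C, P C -> F C <= F B.
Proof. by move=> PB0; case: (arg_maxnP F PB0) => B; exists B. Qed.

Lemma basis_swap B1 B2 x : B1 \in bases M -> B2 \in bases M ->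
  x \in B1 :\: B2 -> exists2 y, y \in B2 :\: B1 & y |: (B1 :\ x) \in bases M.
Proof.
move=> B1M B2M xB; have /forall_inP/(_ _ B1M) := bases_exchange M.
move=> /forall_inP/(_ _ B2M)/forall_inP/(_ _ xB)/existsP[y /andP[yB yM]].
by exists y.
Qed.

(** The additive form avoids truncated subtraction. *)
Lemma card_swapI B x y X : x \in B -> y \notin B ->
  #|X :&: (y |: (B :\ x))| + (x \in X) = #|X :&: B| + (y \in X).
Proof.
move=> xB yB; rewrite setIUr setIDA.
have -> : X :&: [set y] = if y \in X then [set y] else set0.
  apply/setP => z; case: ifP => yX; rewrite !inE; last by case: eqP => [->|]; rewrite ?yX ?andbF.
  by case: eqP => [->|]; rewrite ?yX ?andbF.
rewrite cardsU (cardsD1 x (X :&: B)) inE xB andbT.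
have -> : (if y \in X then [set y] else set0) :&: (X :&: B :\ x) = set0.
  apply/setP => z; case: ifP => yX; rewrite !inE //.
  by case: eqP => [->|] //; rewrite (negPf yB) !andbF.
by rewrite cards0; case: (y \in X); rewrite ?cards1 ?cards0; lia.
Qed.

(** Among the bases of the size of [B1], take one meeting [B2] most. If it were larger than [B2], an
    exchange would keep its size and enlarge that intersection. *)
Lemma bases_card B1 B2 : B1 \in bases M -> B2 \in bases M -> #|B1| = #|B2|.
Proof.
wlog suff card_le : B1 B2 / B1 \in bases M -> B2 \in bases M -> #|B1| <= #|B2|.
  by move=> B1M B2M; apply/eqP; rewrite eqn_leq !card_le.
move=> B1M B2M; pose P B := (B \in bases M) && (#|B| == #|B1|).
have P1 : P B1 by rewrite /P B1M eqxx.
have [B /andP[BM /eqP cB] Bmax] := ex_max_set (fun B => #|B2 :&: B|) P1.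
rewrite leqNgt -cB; apply/negP => ltB.
have [x xB] : exists x, x \in B :\: B2.
  apply/set0Pn; rewrite -card_gt0 cardsD subn_gt0.
  by rewrite (leq_ltn_trans _ ltB) // subset_leq_card // subsetIr.
have [y] := basis_swap BM B2M xB.
move: xB; rewrite !inE => /andP[xB2 xB] /andP[yB yB2] swapM.
have cardT := card_swapI setT xB yB; rewrite !setTI !inE in cardT.
have cardI := card_swapI B2 xB yB; rewrite (negPf xB2) yB2 in cardI.
have: P (y |: (B :\ x)) by apply/andP; split=> //; apply/eqP; rewrite -cB (addIn cardT).
by move=> /Bmax; move: cardI; clear; lia.
Qed.

Lemma rk_ge B X : B \in bases M -> #|X :&: B| <= rk M X.
Proof. by move=> BM; rewrite /rk /rk_of; apply: (bigop.bigmax_sup B). Qed.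

Lemma rk_attained X : exists2 B, B \in bases M & #|X :&: B| = rk M X.
Proof.
have [|B BM rkB] := @eq_bigmax_cond _ (mem (bases M)) (fun B => #|X :&: B|).
  by have /set0Pn[B BM] := bases_nonempty M; rewrite (cardD1 B) BM.
by exists B.
Qed.

Lemma mrankE B : B \in bases M -> mrank M = #|B|.
Proof.
move=> BM; have [B' B'M] := rk_attained setT.
by rewrite setTI (bases_card B'M BM) => ->.
Qed.

Lemma rk_mono X Y : X \subset Y -> rk M X <= rk M Y.
Proof.
move=> sXY; have [B BM <-] := rk_attained X.
by apply: leq_trans (rk_ge Y BM); rewrite subset_leq_card // setSI.
Qed.

Lemma rk_card X : rk M X <= #|X|.
Proof.
by have [B BM <-] := rk_attained X; rewrite subset_leq_card // subsetIl.
Qed.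

Lemma rk_mrank X : rk M X <= mrank M.
Proof. exact: rk_mono (subsetT X). Qed.

Lemma rk_basis B : B \in bases M -> rk M B = #|B|.
Proof.
by move=> BM; have := rk_ge B BM; have := rk_card B; rewrite setIid; lia.
Qed.

Lemma basisP B : (B \in bases M) = (#|B| == mrank M) && (rk M B == #|B|).
Proof.
apply/idP/andP => [BM|[/eqP cB /eqP rB]].
  by rewrite (mrankE BM) rk_basis ?eqxx.
have [B' B'M cI] := rk_attained B.
suff -> : B = B' by [].
apply/eqP; rewrite eqEcard -(mrankE B'M) cB leqnn andbT.
by apply/setIidPl/eqP; rewrite eqEcard subsetIl cI rB leqnn.
Qed.

(** Among the bases attaining [rk M X], maximize [#|Y :&: B| + #|B2 :&: B|], where [B2] attains
    [rk M Y]. If the rank of [Y] is not reached, some element of [B] lies outside [Y] and [B2];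
    exchanging it with an element of [B2] increases the sum. *)
Lemma rk_attained2 X Y : X \subset Y -> exists2 B, B \in bases M &
  #|X :&: B| = rk M X /\ #|Y :&: B| = rk M Y.
Proof.
move=> sXY; have [B1 B1M r1] := rk_attained X.
have [B2 B2M r2] := rk_attained Y.
pose P B := (B \in bases M) && (#|X :&: B| == rk M X).
have P1 : P B1 by rewrite /P B1M r1 eqxx.
have [B /andP[BM /eqP rB] Bmax] :=
  ex_max_set (fun B => #|Y :&: B| + #|B2 :&: B|) P1.
exists B => //; split=> //.
apply/eqP; rewrite eqn_leq rk_ge // leqNgt; apply/negP => ltB.
have cB := bases_card BM B2M.
have [x xB] : exists x, x \in (B :\: B2) :\: Y.
  apply/set0Pn; apply: contraL ltB => /eqP D0; rewrite -leqNgt -r2.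
  have sBY : B :\: Y \subset B2 :\: Y.
    apply/subsetP => z; rewrite !inE => /andP[zY zB]; rewrite zY /=.
    by have /setP/(_ z) := D0; rewrite !inE zY zB andbT => /negbFE.
  have := subset_leq_card sBY; have := cardsID Y B; have := cardsID Y B2.
  rewrite !(setIC Y); move: cB; clear; lia.
move: xB; rewrite inE => /andP[xY xB].
have [y] := basis_swap BM B2M xB.
move: xB; rewrite !inE => /andP[xB2 xB] /andP[yB yB2] swapM.
have xX : x \notin X by apply: contra xY; apply: (subsetP sXY).
have cX := card_swapI X xB yB; have cY := card_swapI Y xB yB.
have c2 := card_swapI B2 xB yB.
rewrite ?(negPf xX) ?(negPf xY) ?(negPf xB2) ?yB2 in cX cY c2.
have: P (y |: (B :\ x)).
  apply/andP; split; first by [].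
  rewrite eqn_leq rk_ge // -rB; move: cX; rewrite addn0 => ->.
  exact: leq_addr.
by move=> /Bmax; move: cY c2; clear; lia.
Qed.

(** A single basis attains the ranks of both the intersection and the union, and for a fixed basis
    the counts are modular. *)
Lemma rk_submod X Y : rk M (X :|: Y) + rk M (X :&: Y) <= rk M X + rk M Y.
Proof.
have [|B BM [<- <-]] := @rk_attained2 (X :&: Y) (X :|: Y).
  exact: subset_trans (subsetIl _ _) (subsetUl _ _).
apply: leq_trans (leq_add (rk_ge X BM) (rk_ge Y BM)).
by rewrite setIUl setIIl cardsUI.
Qed.

Lemma rk0 : rk M set0 = 0.
Proof. by apply/eqP; rewrite -leqn0 (leq_trans (rk_card _)) ?cards0. Qed.

Lemma rk_setD X Y : rk M Y <= rk M X + #|Y :\: X|.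
Proof.
have := rk_submod X (Y :\: X); have := rk_card (Y :\: X).
have : rk M Y <= rk M (X :|: (Y :\: X)).
  by apply: rk_mono; apply/subsetP => y; rewrite !inE => ->; case: (y \in X).
lia.
Qed.

Lemma rkU1 x X : rk M (x |: X) <= (rk M X).+1.
Proof.
have := rk_submod [set x] X; have := rk_card [set x]; rewrite cards1; lia.
Qed.

End Rank.

(** * Base polytopes *)

Local Notation mass x S := (\sum_(i in S) x i).

Lemma base_polytope_convex n (M : matroid n) (x y z : 'I_n -> R) (a b : R) :
    in_base_polytope M x -> in_base_polytope M y -> 0 <= a -> 0 <= b ->
    a + b = 1 -> (forall i, z i = a * x i + b * y i) ->
  in_base_polytope M z.
Proof.
move=> [l [l0 [l1 lx]]] [m [m0 [m1 my]]] a0 b0 ab zE.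
exists (fun B => a * l B + b * m B); split; [|split].
- by move=> B; rewrite addr_ge0 ?mulr_ge0.
- by rewrite big_split /= -!mulr_sumr l1 m1 !mulr1.
- move=> i; rewrite zE lx my !mulr_sumr -big_split.
  by apply: eq_bigr => B _; rewrite mulrDl !mulrA.
Qed.

Lemma base_polytope_vertex n (M : matroid n) B (x : 'I_n -> R) :
  B \in bases M -> (forall i, x i = (i \in B)%:R) -> in_base_polytope M x.
Proof.
move=> BM xE; exists (fun C => (C == B)%:R); split; [|split].
- by move=> C; rewrite ler0n.
- rewrite (bigD1 B) //= eqxx big1 ?addr0 // => C /andP[_ /negPf->] //.
- move=> i; rewrite xE (bigD1 B) //= eqxx mul1r big1 ?addr0 //.
  by move=> C /andP[_ /negPf->]; rewrite mul0r.
Qed.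

(** Writes a point as a convex combination of the two points reached by moving mass between two
    coordinates, by [t] one way and by [u] the other way. *)
Lemma shift_average (F : fieldType) (x a b t u : F) : t + u != 0 ->
  x = u / (t + u) * (x + t * a - t * b) + t / (t + u) * (x + u * b - u * a).
Proof. by move=> tu; field. Qed.

(** * Integrality of polytopes defined by submodular bounds *)

Section Uncrossing.
Variables (n : nat) (rho : {set 'I_n} -> nat).
Hypothesis rho_submod :
  forall S T, (rho (S :|: T) + rho (S :&: T) <= rho S + rho T)%N.
Hypothesis rho_unit : forall i, (rho [set i] <= 1)%N.
Implicit Types (S T B : {set 'I_n}) (x y : 'I_n -> R) (i j : 'I_n).

(** The base polytope of the submodular function [rho], within the nonnegative orthant. *)
Definition base_point x : Prop :=
  [/\ forall i, 0 <= x i, forall S, mass x S <= (rho S)%:R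
    & mass x [set: 'I_n] = (rho [set: 'I_n])%:R].

Let tight x S : bool := mass x S == (rho S)%:R.
Let fractional x i : bool := 0 < x i < (rho [set i])%:R.
(** Induction measure: a move to the boundary makes a new set tight or a new coordinate zero. *)
Let slackness x : nat := (#|[set S | ~~ tight x S]| + #|[set i | x i != 0%R]|)%N.

Definition shift x i j (t : R) : 'I_n -> R :=
  fun l => x l + t * (l == i)%:R - t * (l == j)%:R.

Lemma mass_shift x i j t S :
  mass (shift x i j t) S = mass x S + t * (i \in S)%:R - t * (j \in S)%:R.
Proof.
have sum_pickS l : \sum_(k in S) t * (k == l)%:R = t * (l \in S)%:R.
  rewrite -mulr_sumr; congr (_ * _); have [lS|lS] := boolP (l \in S).
    by rewrite (bigD1 l) //= eqxx big1 ?addr0 // => k /andP[_ /negPf->].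
  by apply: big1 => k kS; case: eqP => // kl; rewrite -kl kS in lS.
by rewrite !big_split /= sumrN !sum_pickS.
Qed.

(** Take for [t] the largest admissible step. Tight sets contain both or neither of [i] and [j],
    hence stay tight, and zero coordinates stay zero; the constraint that stops the move is a new
    tight set or the vanishing of coordinate [j]. *)
Lemma shift_to_boundary x i j : base_point x -> i != j -> 0 < x i -> 0 < x j ->
    (forall T, tight x T -> (i \in T) = (j \in T)) ->
  exists2 t, 0 < t & base_point (shift x i j t) /\
    (slackness (shift x i j t) < slackness x)%N.
Proof.
move=> [x0 xrho xT] neij xi xj tightE.
(* [None] stands for nonnegativity of coordinate [j], and [Some T] for the bound on a set [T] whose
   mass grows along the move. *)
pose P (o : option {set 'I_n}) :=
  if o is Some T then (i \in T) && (j \notin T) else true.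
pose F (o : option {set 'I_n}) : R :=
  if o is Some T then (rho T)%:R - mass x T else x j.
have [o oP oF] : exists2 o, P o & forall o', P o' -> F o <= F o'.
  by case: (@arg_minP _ _ _ None P F isT) => o; exists o.
have F0 o' : P o' -> 0 < F o'.
  case: o' => //= S /andP[iS jS]; rewrite subr_gt0 lt_neqAle xrho andbT.
  by apply/negP => /tightE; rewrite iS (negPf jS).
have t0 := F0 _ oP; pose t := F o; exists t => //.
have txj : t <= x j by apply: (oF None).
have x'0 l : 0 <= shift x i j t l.
  rewrite /shift; case: (eqVneq l j) => [->|lj].
    by rewrite eq_sym (negPf neij) mulr0 addr0 mulr1 subr_ge0.
  by rewrite mulr0 subr0 addr_ge0 // mulr_ge0 // ltW.
have x'rho S : mass (shift x i j t) S <= (rho S)%:R.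
  rewrite mass_shift; case iS: (i \in S); case jS: (j \in S);
    rewrite ?mulr1 ?mulr0 ?subr0 ?addr0 ?addrK //.
    by rewrite -lerBrDl; apply: (oF (Some S)); rewrite /= iS jS.
  by rewrite lerBlDr (le_trans (xrho S)) // lerDl ltW.
split.
  by split=> //; rewrite mass_shift !in_setT addrK.
pose tight_x' := [set S | ~~ tight (shift x i j t) S].
pose pos_x' := [set l | shift x i j t l != 0].
have sub_tight : tight_x' \subset [set S | ~~ tight x S].
  apply/fintype.subsetP => S; rewrite !inE; apply: contra => tS.
  by rewrite /tight mass_shift (tightE _ tS) addrK.
have sub_pos : pos_x' \subset [set l | x l != 0].
  apply/fintype.subsetP => l; rewrite !inE; apply: contra => /eqP xl.
  rewrite /shift xl; case: (eqVneq l i) => [li|_]; first by rewrite -li xl ltxx in xi.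
  case: (eqVneq l j) => [lj|_]; first by move: xj; rewrite -lj xl ltxx.
  by rewrite mulr0 subr0 addr0.
rewrite /slackness -/tight_x' -/pos_x'; move: (subset_leq_card sub_tight).
move: (subset_leq_card sub_pos) => cp ct.
case: o @t oP t0 txj x'0 x'rho @tight_x' @pos_x' sub_tight sub_pos cp ct oF {F0}.
  move=> S t /andP[iS jS] t0 _ _ _ tight_x' pos_x' sub_tight _ cp _ _.
  rewrite -addSn leq_add // proper_card // fintype.properE sub_tight.
  apply/negP => /fintype.subsetP/(_ S); rewrite !inE /tight mass_shift iS (negPf jS).
  rewrite mulr1 mulr0 subr0 /t /= addrC subrK eqxx /=.
  by move/(_ _)/negP; apply=> //; rewrite /tight; apply/negP=> /tightE; rewrite iS (negPf jS).
move=> t _ t0 _ _ _ tight_x' pos_x' _ sub_pos _ ct _.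
rewrite -addnS leq_add // proper_card // fintype.properE sub_pos.
apply/negP => /fintype.subsetP/(_ j); rewrite !inE /shift eqxx [j == i]eq_sym (negPf neij).
by rewrite mulr0 addr0 mulr1 /t /= subrr eqxx gt_eqF // => /(_ isT).
Qed.

(** Mass is modular and [rho] is submodular, so the slacks of union and intersection add up to at
    most those of [S] and [T], which vanish. *)
Lemma tight_setI x S T : base_point x -> tight x S -> tight x T ->
  tight x (S :&: T).
Proof.
move=> [_ xrho _] /eqP tS /eqP tT; rewrite /tight eq_le xrho /=.
have massUI : mass x (S :|: T) + mass x (S :&: T) = mass x S + mass x T.
  rewrite (big_setID S (A := S :|: T)) /= setUK setDUl setDv set0U.
  by rewrite (big_setID S (A := T)) /= (setIC T S) -addrA [_ + mass x (S :&: T)]addrC.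
have := xrho (S :|: T); have := rho_submod S T.
rewrite -(ler_nat R) !natrD -tS -tT -massUI.
lra.
Qed.

Lemma natural_between (a b : nat) (t : R) : 0 < t < 1 -> a%:R + t != b%:R.
Proof.
move=> /andP[t0 t1]; apply/eqP => ab.
have : (a%:R < b%:R :> R) && (b%:R < a.+1%:R :> R).
  by rewrite -ab -addn1 natrD ltrDl t0 ltrD2l.
rewrite !ltr_nat; lia.
Qed.

Lemma fractionalP x i : fractional x i -> 0 < x i < 1.
Proof.
move=> /andP[-> xi]; rewrite (lt_le_trans xi) //.
by have := rho_unit i; rewrite -(ler_nat R).
Qed.

Lemma integralP x i : base_point x -> ~~ fractional x i -> x i = (x i != 0)%:R.
Proof.
move=> [x0 xrho _]; have := xrho [set i]; rewrite big_set1 /fractional.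
case: eqP => [->//|/eqP xi]; rewrite lt_neqAle eq_sym xi x0 /= -leNgt => le ge.
have xE : x i = (rho [set i])%:R by apply/le_anti; rewrite le ge.
move: xi (rho_unit i); rewrite xE /=.
by case: (rho [set i]) => [|[|]] //; rewrite eqxx.
Qed.

Lemma mass_integral x S : base_point x ->
    {in S, forall i, ~~ fractional x i} ->
  mass x S = #|[set i in S | x i != 0]|%:R.
Proof.
move=> xQ Sint; rewrite -sum1dep_card big_mkcondr natr_sum.
apply: eq_bigr => i iS; rewrite [LHS](integralP xQ (Sint i iS)).
by case: (x i != 0).
Qed.

(* A minimal tight set S containing a fractional coordinate i contains a second
   one j, since rho S is an integer.  Tight sets are closed under intersection,
   so by minimality every tight set contains both i and j or neither. *)
Lemma exchange_direction x : base_point x -> (exists i, fractional x i) ->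
  exists i j, [/\ i != j, 0 < x i, 0 < x j &
    forall T, tight x T -> (i \in T) = (j \in T)].
Proof.
move=> xQ [i0 i0frac].
pose P S := tight x S && [exists i in S, fractional x i].
have PT : P [set: 'I_n].
  rewrite /P /tight; case: xQ => _ _ ->; rewrite eqxx.
  by apply/existsP; exists i0; rewrite inE.
case: (arg_minnP (fun S => #|S|) PT) => S.
move=> /andP[tS /existsP[i /andP[iS ifrac]]] Smin.
have Smin' l T : fractional x l -> l \in S -> tight x T -> l \in T -> S \subset T.
  move=> lfrac lS tT lT; apply/setIidPl/eqP; rewrite eqEcard subsetIl /=.
  apply: Smin; rewrite /P tight_setI //.
  by apply/existsP; exists l; rewrite inE lS lT.
have [j jS /andP[jfrac ji]] : exists2 j, j \in S & fractional x j && (j != i).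
  apply/exists_inP; apply: contraT; rewrite negb_exists_in => /forall_inP nofrac.
  have := natural_between #|[set l in S :\ i | x l != 0]| (rho S) (fractionalP ifrac).
  rewrite -(eqP tS) (big_setD1 i) //= [x i + _]addrC.
  rewrite -(mass_integral xQ) ?eqxx // => l.
  by rewrite !inE => /andP[li /nofrac]; rewrite li andbT.
exists i, j; split; rewrite 1?eq_sym //.
- by have /andP[] := ifrac.
- by have /andP[] := jfrac.
- move=> T tT; apply/idP/idP => inT.
    exact: (fintype.subsetP (Smin' _ _ ifrac iS tT inT)).
  exact: (fintype.subsetP (Smin' _ _ jfrac jS tT inT)).
Qed.

(** Induction on [slackness]. Without fractional coordinates, [x] is the indicator of a set
    satisfying all bounds, which is a basis by hypothesis; otherwise [x] lies between two points of
    smaller slackness. Keeping [rho] abstract lets the result serve both rank functions and cut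
    matroids. *)
Lemma base_point_in_polytope (M : matroid n) x :
    (forall B, (#|B| = rho setT)%N -> (forall S, (#|S :&: B| <= rho S)%N) ->
      B \in bases M) ->
  base_point x -> in_base_polytope M x.
Proof.
move=> basesM; elim: {x}_.+1 {-2}x (ltnSn (slackness x)) => // m IHm x ltm xQ.
have [/existsP fr|] := boolP [exists i, fractional x i]; last first.
  rewrite negb_exists => /forallP nofrac.
  have xE i : x i = (i \in [set i | x i != 0])%:R.
    by rewrite inE; apply: integralP.
  apply: base_polytope_vertex xE.
  have massE S : mass x S = #|S :&: [set i | x i != 0]|%:R.
    rewrite (mass_integral xQ) => [|i _]; last exact: nofrac.
    by congr (#|pred_of_set _|%:R); apply/setP => i; rewrite !inE.
  case: xQ => _ xrho xT; apply: basesM => [|S].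
    by apply/eqP; rewrite -(eqr_nat R) -xT massE setTI.
  by rewrite -(ler_nat R) -massE.
have [i [j [neij xi xj tightE]]] := exchange_direction xQ fr.
have [t t0 [tQ tm]] := shift_to_boundary xQ neij xi xj tightE.
have [|u u0 [uQ um]] := shift_to_boundary xQ _ xj xi (fun T tT => esym (tightE T tT)).
  by rewrite eq_sym.
have tu0 : t + u != 0 by rewrite gt_eqF // addr_gt0.
apply: (@base_polytope_convex n M (shift x i j t) (shift x j i u) x
  (u / (t + u)) (t / (t + u))).
- by apply: IHm => //; apply: leq_trans tm _.
- by apply: IHm => //; apply: leq_trans um _.
- by rewrite divr_ge0 // ?addr_ge0 // ltW.
- by rewrite divr_ge0 // ?addr_ge0 // ltW.
- by rewrite -mulrDl addrC divff.
- by move=> l; rewrite /shift; exact: shift_average.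
Qed.

End Uncrossing.

(** * Valuativity of the Tutte polynomial *)

(** Edmonds' description of the base polytope: the bounds hold at the bases, hence at their convex
    combinations, and the converse is integrality. *)
Lemma base_polytopeP n (M : matroid n) x :
  in_base_polytope M x <-> base_point (rk M) x.
Proof.
split=> [[l [l0 [l1 lx]]]|xQ].
  have massE (S : {set 'I_n}) : mass x S = \sum_(B in bases M) l B * #|S :&: B|%:R.
    under eq_bigr do rewrite lx.
    rewrite exchange_big; apply: eq_bigr => B _ /=.
    rewrite -mulr_sumr; congr (_ * _); rewrite -sum1_card natr_sum.
    rewrite [RHS](eq_bigl (fun i => (i \in S) && (i \in B))); last first.
      by move=> i; rewrite inE.
    by rewrite big_mkcondr; apply: eq_bigr => i _; case: (i \in B).
  have const_mass c : c = \sum_(B in bases M) l B * c.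
    by rewrite -mulr_suml l1 mul1r.
  split=> [i|S|].
  - by rewrite lx sumr_ge0 // => B _; rewrite mulr_ge0 ?ler0n.
  - rewrite massE [leRHS]const_mass ler_sum // => B BM.
    by apply: ler_wpM2l; rewrite ?ler_nat ?rk_ge.
  - rewrite massE [RHS]const_mass; apply: eq_bigr => B BM.
    by rewrite setTI -/(mrank M) (mrankE BM).
apply: base_point_in_polytope xQ => [|i|B cB rB].
- exact: rk_submod.
- by rewrite -(cards1 i) rk_card.
- have := rB B; have := rk_card M B; rewrite setIid basisP cB eqxx /= => le ge.
  by rewrite eqn_leq le ge.
Qed.

Section RankValuation.
Variables (n : nat) (s : seq (int * matroid n)).
Hypothesis relation :
  forall x, \sum_(p <- s) p.1 * ind_base_polytope p.2 x = 0.

(** The negated rows are lower bounds: the first, together with the row of [setT], forces the total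
    mass to be the rank, and the second cuts the polytope by [x(X) >= j]. *)
Definition rank_halfspaces (M : matroid n) (X : {set 'I_n}) (j : nat) :
    seq (('I_n -> R) * R) :=
  let ind (S : {set 'I_n}) := fun i => (i \in S)%:R : R in
  [:: (fun i => - ind setT i, - (mrank M)%:R); (fun i => - ind X i, - j%:R)]
  ++ [seq (ind T, (rk M T)%:R) | T <- enum {set 'I_n}].

Lemma rank_halfspacesP M X j x : in_box (rank_halfspaces M X j) x <->
  in_base_polytope M x /\ j%:R <= mass x X.
Proof.
have sum_ind (S : {set 'I_n}) : \sum_i (i \in S)%:R * x i = mass x S.
  by rewrite [RHS]big_mkcond; apply: eq_bigr => i _; case: (i \in S);
    rewrite ?mul1r ?mul0r.
have sum_indN (S : {set 'I_n}) : \sum_i - (i \in S)%:R * x i = - mass x S.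
  by rewrite -sum_ind -sumrN; apply: eq_bigr => i _; rewrite mulNr.
have allE : all (fun c => halfspace c x) (rank_halfspaces M X j) =
    [&& (mrank M)%:R <= mass x setT, j%:R <= mass x X
      & [forall S : {set 'I_n}, mass x S <= (rk M S)%:R]].
  rewrite all_cat /= andbT /halfspace /= !sum_indN !lerN2 -andbA.
  congr [&& _, _ & _]; rewrite all_map; apply/allP/forallP => xS S.
    by have := xS S; rewrite /= sum_ind mem_enum; apply.
  by move=> _; rewrite /= sum_ind.
rewrite /in_box allE base_polytopeP; split.
  move=> /and4P[/forallP x01 xT xX /forallP xS]; split=> //; split=> //.
    by move=> i; have /andP[] := x01 i.
  by apply/le_anti; rewrite xS xT.
move=> [[x0 xS xT] xX]; apply/and4P; split=> //.
- apply/forallP => i; rewrite x0 /=; have := xS [set i]; rewrite big_set1.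
  move=> /le_trans; apply; rewrite -[leRHS]/(1%:R) ler_nat.
  by rewrite -(cards1 i) rk_card.
- by rewrite xT.
- exact/forallP.
Qed.

(** The vertex of a basis attaining [rk M X] has the largest mass on [X]. *)
Lemma rank_halfspaces_nonempty M X j :
  (exists x, in_box (rank_halfspaces M X j) x) <-> (j <= rk M X)%N.
Proof.
split=> [[x /rank_halfspacesP[/base_polytopeP[_ xS _] xX]]|jr].
  by rewrite -(ler_nat R) (le_trans xX).
have [B BM rB] := rk_attained M X.
exists (fun i => (i \in B)%:R); apply/rank_halfspacesP; split.
  exact: base_polytope_vertex BM _.
rewrite -natr_sum ler_nat (leq_trans jr) // -rB -sum1_card.
rewrite (eq_bigl (fun i => (i \in X) && (i \in B))); last first.
  by move=> i; rewrite inE.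
by rewrite big_mkcondr leq_sum // => i _; case: (i \in B).
Qed.

(** Multiplying the relation by the indicator of the half-space [x(X) >= j] gives a relation between
    boxes, to which [euler_boxes] applies. *)
Lemma rank_geq_valuative X j : \sum_(p <- s) p.1 * (j <= rk p.2 X)%N%:R = 0.
Proof.
rewrite big_tnth; set t := tnth _.
transitivity (\sum_i (t i).1 *
    (asbool (exists x, in_box (rank_halfspaces (t i).2 X j) x))%:R).
  apply: eq_bigr => i _; congr (_ * (nat_of_bool _)%:R).
  by apply/idP/asboolP; apply rank_halfspaces_nonempty.
apply: euler_boxes => x.
transitivity ((\sum_(p <- s) p.1 * ind_base_polytope p.2 x) *
  (j%:R <= mass x X)%R%:R); last by rewrite relation mul0r.
rewrite [in RHS]big_tnth mulr_suml; apply: eq_bigr => i _.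
rewrite -/(t i) -mulrA /ind_base_polytope -natrM mulnb; congr (_ * (nat_of_bool _)%:R).
by apply/idP/andP => [/rank_halfspacesP[/asboolP]|[/asboolP xM xX]] //;
  apply/rank_halfspacesP.
Qed.

(** The indicator of [rk X = j] is the difference of those of [rk X >= j] and [rk X >= j.+1], and
    any function of [rk X] is a combination of such indicators. *)
Lemma rank_function_valuative (A : zmodType) X (G : nat -> A) :
  \sum_(p <- s) G (rk p.2 X) *~ p.1 = 0.
Proof.
have rank_eq j : \sum_(p <- s) p.1 * (rk p.2 X == j)%:R = 0.
  transitivity (\sum_(p <- s) p.1 * (j <= rk p.2 X)%N%:R -
    \sum_(p <- s) p.1 * (j.+1 <= rk p.2 X)%N%:R).
    rewrite -sumrB; apply: eq_bigr => p _; rewrite -mulrBr; congr (_ * _).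
    by case: ltngtP.
  by rewrite !rank_geq_valuative subrr.
transitivity (\sum_(p <- s) \sum_(j < n.+1) G j *~ (p.1 * (rk p.2 X == j)%:R)).
  apply: eq_bigr => p _.
  have rn : (rk p.2 X < n.+1)%N.
    by rewrite ltnS (leq_trans (rk_card _ _)) // -[leqRHS]card_ord max_card.
  rewrite (bigD1 (Ordinal rn)) //= eqxx mulr1 big1 ?addr0 // => j nj.
  rewrite (_ : (_ == _) = false) ?mulr0 ?mulr0z //.
  by apply: contraNF nj => /eqP rE; apply/eqP/val_inj.
rewrite exchange_big big1 // => j _.
by rewrite -mulrz_sumr rank_eq.
Qed.

End RankValuation.

Lemma tutte_valuative n k : valuative_on k (@tutte n).
Proof.
move=> s rks rel.
under eq_bigr do rewrite /tutte mulrz_suml.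
rewrite exchange_big big1 // => X _ /=.
(* All matroids of the relation have rank [k], so the term of [X] depends on [rk X] alone. *)
pose G r : {poly {poly int}} := (('X : {poly int})%:P - 1) ^+ (k - r)%N *
  ('X - 1) ^+ (#|X| - r)%N.
transitivity (\sum_(p <- s) G (rk p.2 X) *~ p.1); last first.
  exact: (rank_function_valuative rel X G).
elim: s rks {rel} => [|p s IHs] /=; first by rewrite !big_nil.
by move=> /andP[/eqP rp /IHs]; rewrite !big_cons => ->; rewrite /G -rp.
Qed.

(** * Invariance under isomorphism *)

Lemma rk_isom n (M M' : matroid n) (g : {perm 'I_n}) (X : {set 'I_n}) :
    bases M' = [set [set g i | i in B] | B : {set 'I_n} in bases M] ->
  rk M' (g @: X) = rk M X.
Proof.
move=> M'E.
have cardgI (B : {set 'I_n}) : #|g @: X :&: g @: B| = #|X :&: B|.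
  by rewrite -imsetI ?card_imset //; [exact: perm_inj|move=> i j _ _; exact: perm_inj].
apply/eqP; rewrite eqn_leq; apply/andP; split.
  have [B' + <-] := rk_attained M' (g @: X).
  by rewrite M'E => /imsetP[B BM ->]; rewrite cardgI rk_ge.
have [B BM <-] := rk_attained M X.
by rewrite -cardgI rk_ge // M'E imset_f.
Qed.

Lemma tutte_isom n (M M' : matroid n) : misom M M' -> tutte M = tutte M'.
Proof.
move=> [g M'E]; rewrite /tutte [RHS](reindex (fun X : {set 'I_n} => g @: X)) /=; last first.
  exists (fun X : {set 'I_n} => g^-1%g @: X) => X _; rewrite -imset_comp -[RHS]imset_id.
    by apply: eq_imset => i /=; rewrite permK.
  by apply: eq_imset => i /=; rewrite permKV.
apply: eq_bigr => X _; rewrite -(rk_isom setT M'E) -(rk_isom X M'E).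
rewrite card_imset; last exact: perm_inj.
by rewrite (_ : g @: setT = setT) //; apply/setP => i; rewrite inE -(permKV g i) imset_f.
Qed.

(** * Cyclic flats of elementary split matroids *)

Ltac rk_lia := clear;
  repeat match goal with
  | |- context [mrank ?M] => move: (mrank M) => ?
  | |- context [rk ?M ?X] => move: (rk M X) => ?
  | |- context [#|?X|] => move: (#|X|) => ?
  end; lia.

Section SplitStructure.
Variables (n : nat) (M : matroid n).
Implicit Types (X Y Z S T F G : {set 'I_n}) (x y e : 'I_n).
Local Open Scope nat_scope.

Local Notation r := (rk M).

(** Closure is monotone: apply submodularity to [x |: X] and [Y], whose intersection contains
    [X]. *)
Lemma rk_closure x X Y : X \subset Y -> r (x |: X) = r X -> r (x |: Y) = r Y.
Proof.
move=> sXY rx; apply/eqP; rewrite eqn_leq (rk_mono _ (subsetUr _ _)) andbT.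
have := rk_submod M (x |: X) Y.
have -> : (x |: X) :|: Y = x |: Y by rewrite -setUA (setUidPr sXY).
have : r X <= r ((x |: X) :&: Y) by rewrite rk_mono // subsetI subsetUr.
by move: rx; rk_lia.
Qed.

Lemma dependent_element X : r X < #|X| -> exists2 x, x \in X & r (X :\ x) = r X.
Proof.
move=> dep; have [B BM rB] := rk_attained M X.
have [x] : exists x, x \in X :\: B.
  by apply/set0Pn; rewrite -card_gt0 cardsD rB subn_gt0.
rewrite inE => /andP[xB xX]; exists x => //; apply/eqP.
rewrite eqn_leq rk_mono ?subsetDl // -rB.
have -> : X :&: B = (X :\ x) :&: B; last exact: rk_ge.
by apply/setP => y; rewrite !inE; case: eqP => // ->; rewrite (negPf xB) andbF.
Qed.

Lemma extending_element X : r X < mrank M ->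
  exists2 x, x \notin X & r (x |: X) = (r X).+1.
Proof.
move=> ltX; have [B BM [rX rT]] := rk_attained2 M (subsetT X).
have [x] : exists x, x \in B :\: X.
  apply/set0Pn; rewrite -card_gt0 cardsD subn_gt0 setIC rX.
  by rewrite -[B]setTI rT.
rewrite inE => /andP[xX xB]; exists x => //; apply/eqP.
rewrite eqn_leq rkU1 -rX; apply: leq_trans (rk_ge _ BM).
have -> : (x |: X) :&: B = x |: (X :&: B).
  by rewrite setIUl; congr (_ :|: _); apply/setIidPl; rewrite sub1set.
by rewrite cardsU1 inE (negPf xX).
Qed.

(** The first condition discards the independent and the spanning sets, whose rank inequalities
    already hold on the whole hypersimplex. *)
Definition proper_cyclic_flats : {set {set 'I_n}} :=
  [set F | [&& r F < minn #|F| (mrank M),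
    [forall x in F, r (F :\ x) == r F]
    & [forall x, (x \notin F) ==> (r F < r (x |: F))]]].

(* Among the T with rk T + |S :\: T| minimal, adding a spanned element or
   deleting a coloop would increase |T| + 2 (k - rk T), so a maximizer is a
   cyclic flat. *)
Lemma cyclic_flat_cover S : r S < minn #|S| (mrank M) ->
  exists2 F, F \in proper_cyclic_flats & r F + #|S :\: F| = r S.
Proof.
move=> ltS; pose P T := r T + #|S :\: T| == r S.
have PS : P S by rewrite /P setDv cards0 addn0.
have [T /eqP PT Tmax] := ex_max_set (fun T => #|T| + 2 * (mrank M - r T)) PS.
have cST := cardsID T S; have cTS := subset_leq_card (subsetIr S T).
exists T => //; rewrite inE; apply/and3P; split.
- by move: ltS PT cST cTS; rk_lia.
- apply/forall_inP => x xT; have le := rk_mono M (subsetDl T [set x]).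
  rewrite eqn_leq le leqNgt; apply/negP => lt.
  have leS : #|S :\: (T :\ x)| <= (#|S :\: T|).+1.
    rewrite -add1n -(cards1 x); apply: leq_trans (leq_card_setU _ _).
    apply: subset_leq_card; apply/fintype.subsetP => y; rewrite !inE.
    by case: (y == x).
  have := Tmax (T :\ x); have := rkU1 M x (T :\ x); rewrite setD1K //.
  have := rk_setD M (T :\ x) S; have := cardsD1 x T; rewrite xT.
  have := rk_mrank M T; rewrite /P => h1 h2 h3 h4.
  have -> : r (T :\ x) + #|S :\: (T :\ x)| == r S.
    by move: lt leS h3 h4 PT; rk_lia.
  by move=> /(_ isT); move: lt h1 h2 h4; rk_lia.
- apply/forallP => x; apply/implyP => xT; rewrite ltnNge; apply/negP => le.
  have leS : #|S :\: (x |: T)| <= #|S :\: T|.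
    by rewrite subset_leq_card // setDS // subsetUr.
  have := Tmax (x |: T); have := rk_setD M (x |: T) S.
  have := rk_mono M (subsetUr [set x] T); rewrite cardsU1 xT /P => h1 h2.
  have -> : r (x |: T) + #|S :\: (x |: T)| == r S.
    by move: le leS h1 h2 PT; rk_lia.
  by move=> /(_ isT); move: le h1; rk_lia.
Qed.

End SplitStructure.

(** * Producing the forbidden minor *)

Section ForbiddenMinor.
Local Open Scope nat_scope.

Lemma rk_U01_U12_U11 (X : {set 'I_4}) : rk_of U01_U12_U11_bases X =
  ((inord 1 \in X) || (inord 2 \in X)) + (inord 3 \in X).
Proof.
have neq (i j : nat) : i < 4 -> j < 4 -> i != j -> (inord i : 'I_4) != inord j.
  by move=> i4 j4 ij; rewrite -val_eqE /= !inordK.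
have cardI (a b : 'I_4) : a != b -> #|X :&: [set a; b]| = (a \in X) + (b \in X).
  move=> ab; rewrite setIUr cardsU.
  have c1 c : #|X :&: [set c]| = (c \in X).
    have [cX|cX] := boolP (c \in X).
      by rewrite (setIidPr _) ?cards1 ?sub1set.
    by apply/eqP; rewrite cards_eq0 setI_eq0 disjoint_sym disjoints1.
  rewrite !c1 -setIIr (_ : [set a] :&: [set b] = set0) ?setI0 ?cards0 ?subn0 //.
  by apply/eqP; rewrite setI_eq0 disjoints1 inE.
rewrite /rk_of /U01_U12_U11_bases big_setU1 ?big_set1 /=; last first.
  rewrite inE; apply/eqP => /setP/(_ (inord 1)); rewrite !inE eqxx /=.
  by rewrite !(negPf (neq _ _ _ _ _)).
rewrite !cardI ?neq //.
by case: (inord 1 \in X); case: (inord 2 \in X); case: (inord 3 \in X).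
Qed.

(* With C maximal among the sets between Z and G :\ e whose span misses e, and
   l \in Z redundant in Z, contracting C :\ l leaves l a loop, a parallel to e
   for any a \in G outside C and e, and c a coloop for any c outside the span
   of G. *)
Lemma cyclic_independent n (M : matroid n) (Z G : {set 'I_n}) e :
    elementary_split M -> Z \subset G -> e \in G -> rk M (G :\ e) = rk M G ->
    rk M Z < rk M (e |: Z) -> rk M G < mrank M ->
  #|Z| <= rk M Z.
Proof.
move=> splitM sZG eG cyclic_e eZ ltG; rewrite leqNgt; apply/negP => dep.
apply: splitM; have [l lZ rl] := dependent_element dep.
have [c cG rc] := extending_element ltG.
pose P (D : {set 'I_n}) := [&& Z \subset D, D \subset G :\ e & rk M D < rk M (e |: D)].
have eNZ : e \notin Z.
  by apply: contraL eZ => eZ; rewrite (setUidPr _) ?sub1set // ltnn.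
have PZ : P Z by rewrite /P fintype.subxx subsetD1 sZG eNZ eZ.
have [C /and3P[sZC sCG eC] Cmax] := ex_max_set (fun D : {set 'I_n} => #|D|) PZ.
have [a] : exists a, a \in (G :\ e) :\: C.
  apply/set0Pn; rewrite setD_eq0; apply: contraL eC => sGC.
  have -> : C = G :\ e by apply/eqP; rewrite eqEsubset sCG sGC.
  by rewrite setD1K // cyclic_e ltnn.
rewrite !inE => /and3P[aC ae aG].
(* Otherwise [a |: C] would contradict the maximality of [C]. *)
have rae : rk M (e |: (a |: C)) <= rk M (a |: C).
  rewrite leqNgt; apply/negP => lt.
  have PaC : P (a |: C).
    rewrite /P lt andbT (subset_trans sZC) ?subsetUr //=.
    by rewrite subUset sCG sub1set !inE ae aG.
  by have := Cmax _ PaC; rewrite cardsU1 aC add1n ltnn.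
have re : rk M (e |: C) = (rk M C).+1.
  by apply/eqP; rewrite eqn_leq rkU1 eC.
have re_a : rk M (e |: (a |: C)) = (rk M C).+1.
  have := rk_mono M (subsetUr [set a] (e |: C)); rewrite setUCA re => h.
  by move: rae h; have := rkU1 M a C; rk_lia.
have ra : rk M (a |: C) = (rk M C).+1.
  by move: rae re_a; have := rkU1 M a C; rk_lia.
have lC : l \in C by apply: (fintype.subsetP sZC).
have sCG' : C \subset G by apply: subset_trans sCG (subsetDl _ _).
have rlY (Y : {set 'I_n}) : Z :\ l \subset Y -> rk M (l |: Y) = rk M Y.
  by move=> sZY; apply: rk_closure sZY _; rewrite setD1K.
have rcY (Y : {set 'I_n}) : Y \subset G -> rk M (c |: Y) = (rk M Y).+1.
  move=> sYG; apply/eqP; rewrite eqn_leq rkU1 ltnNge; apply/negP => le.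
  have rY : rk M (c |: Y) = rk M Y.
    by apply/eqP; rewrite eqn_leq le rk_mono // subsetUr.
  by have := rk_closure sYG rY; rewrite rc; clear; lia.
have ne_mem (x y : 'I_n) (D : {set 'I_n}) : x \in D -> y \notin D -> x != y.
  by move=> xD; apply: contraNneq => <-.
have eNC : e \notin C.
  by apply/negP => /(fintype.subsetP sCG); rewrite !inE eqxx.
have [la le lc] : [/\ l != a, l != e & l != c].
  by split; [exact: ne_mem lC aC | exact: ne_mem lC eNC |
             exact: ne_mem ((fintype.subsetP sCG') _ lC) cG].
have [ac ec] : a != c /\ e != c by split; [exact: ne_mem aG cG | exact: ne_mem eG cG].
(* The order matches the minor: the loop 0, the parallel pair 1 and 2, the coloop 3. *)
pose g := tnth [tuple l; a; e; c].
have gE : [/\ g (inord 0) = l, g (inord 1) = a, g (inord 2) = e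
             & g (inord 3) = c].
  by rewrite /g; split; rewrite (tnth_nth l) /= inordK.
have mem_g (X : {set 'I_4}) z : (z \in g @: X) =
    [|| (inord 0 \in X) && (z == l), (inord 1 \in X) && (z == a),
        (inord 2 \in X) && (z == e) | (inord 3 \in X) && (z == c)].
  case: gE => g0 g1 g2 g3; apply/imsetP/idP => [[i iX ->]|].
    have : i \in [:: inord 0; inord 1; inord 2; inord 3].
      by case: i {iX} => [[|[|[|[|]]]] lt_i] //; rewrite !inE -!val_eqE /= !inordK.
    by rewrite !inE => /or4P[] /eqP iE; rewrite iE in iX *;
      rewrite iX ?g0 ?g1 ?g2 ?g3 eqxx ?orbT.
  case/or4P => /andP[iX /eqP->]; [exists (inord 0)|exists (inord 1)|
    exists (inord 2)|exists (inord 3)]; by rewrite ?g0 ?g1 ?g2 ?g3.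
exists (C :\ l), g; split; [|split].
- apply/tuple_uniqP; rewrite /= !inE !negb_or la le lc ae ac ec //.
- rewrite disjoint_subset; apply/fintype.subsetP => z.
  rewrite mem_g !in_setT !inE negb_and negbK /=.
  case/or4P => /eqP->; rewrite ?eqxx ?aC ?eNC ?orbT //.
  by rewrite (contra _ cG) ?orbT //; apply: (fintype.subsetP sCG').
move=> X; rewrite rk_U01_U12_U11.
have -> : rk M (C :\ l) = rk M C.
  by rewrite -[in RHS](setD1K lC) rlY // setSD.
pose opt (b : bool) (x : 'I_n) : {set 'I_n} := if b then [set x] else set0.
pose Y := opt (inord 1 \in X) a :|: (opt (inord 2 \in X) e :|: C).
have sYG : Y \subset G.
  by rewrite /Y /opt; do 2!case: ifP => _; rewrite ?set0U ?subUset ?sub1set ?aG ?eG.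
have rY : rk M Y = rk M C + ((inord 1 \in X) || (inord 2 \in X)).
  rewrite /Y /opt; do 2!case: ifP => _; rewrite ?set0U ?ra ?re ?addn0 ?addn1 //=.
  by rewrite setUCA re_a.
have -> : rk M (g @: X :|: C :\ l) = rk M (opt (inord 3 \in X) c :|: Y).
  (* Putting [l] back leaves the rank unchanged and makes the two sets equal, whether or not the
     loop 0 belongs to [X]. *)
  rewrite -rlY; last by rewrite (subset_trans (setSD _ sZC)) ?subsetUr.
  congr (rk M _); apply/setP => z; rewrite /Y !in_setU mem_g !inE.
  have [->|_] := eqVneq z l; first by rewrite lC !orbT.
  have optE b x : (z \in opt b x) = b && (z == x).
    by rewrite /opt; case: b; rewrite inE.
  rewrite !optE andbF /=.
  case: (inord 1 \in X); case: (inord 2 \in X); case: (inord 3 \in X);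
  by case: (z == c); case: (z == a); case: (z == e); case: (z \in C).
have -> : rk M (opt (inord 3 \in X) c :|: Y) = rk M Y + (inord 3 \in X).
  by rewrite /opt; case: ifP => _; rewrite ?set0U ?rcY ?addn0 ?addn1.
by rewrite rY -addnA addKn.
Qed.

End ForbiddenMinor.

(** * Pairs of cyclic flats and the covering formula for ranks *)

Section SplitFlats.
Local Open Scope nat_scope.
Variables (n : nat) (M : matroid n).
Hypothesis splitM : elementary_split M.
Implicit Types (X F G : {set 'I_n}).

Local Notation flats := (proper_cyclic_flats M).

Lemma flatsP F : F \in flats -> [/\ rk M F < #|F|, rk M F < mrank M,
  {in F, forall x, rk M (F :\ x) = rk M F}
  & forall x, x \notin F -> rk M F < rk M (x |: F)].
Proof.
rewrite inE leq_min => /and3P[/andP[lt1 lt2] /forall_inP cyc /forallP flat].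
split=> // [x /cyc/eqP|x] //.
by have /implyP := flat x.
Qed.

(** Take [e] in [G] outside [F]. By [cyclic_independent] inside [G], the intersection is
    independent. The union spans, since otherwise the same lemma inside the union would make [F]
    independent. Submodularity concludes. *)
Lemma flats_cross F G : F \in flats -> G \in flats -> F != G ->
  #|F :&: G| + mrank M <= rk M F + rk M G.
Proof.
wlog [e eG eF] : F G / exists2 e, e \in G & e \notin F.
  move=> wlog_e FM GM neFG.
  have [sGF|/subsetPn[e eG eF]] := boolP (G \subset F).
    have [sFG|/subsetPn[e eF eG]] := boolP (F \subset G).
      by rewrite eqEsubset sFG sGF in neFG.
    by rewrite setIC addnC [_ + rk M G]addnC addnC wlog_e // 1?eq_sym //; exists e.
  by apply: wlog_e => //; exists e.
move=> /flatsP[depF _ _ flatF] /flatsP[_ ltG cycG _] _.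
have eFG : rk M (F :&: G) < rk M (e |: (F :&: G)).
  rewrite ltnNge; apply: contraTN (flatF e eF) => le.
  rewrite -leqNgt (rk_closure (subsetIl F G)) //.
  by apply/eqP; rewrite eqn_leq le rk_mono ?subsetUr.
have indep : #|F :&: G| <= rk M (F :&: G).
  exact: cyclic_independent splitM (subsetIr F G) eG (cycG e eG) eFG ltG.
have span : mrank M <= rk M (F :|: G).
  rewrite leqNgt; apply: contraTN depF => ltFG; rewrite -leqNgt.
  have eFG' : e \in F :|: G by rewrite inE eG orbT.
  apply: (cyclic_independent splitM (subsetUl F G) eFG' _ (flatF e eF) ltFG).
  have sG : G :\ e \subset (F :|: G) :\ e by rewrite setSD ?subsetUr.
  by rewrite -[in RHS](setD1K eFG') (rk_closure sG) // setD1K ?cycG.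
have := rk_submod M F G; move: indep span.
rk_lia.
Qed.

(** For distinct flats, [flats_cross] and the bound of [#|X|] by
    [#|F :&: G| + #|X :\: F| + #|X :\: G|] give [#|X| + mrank M <= 2 * h]. *)
Lemma flats_cover_unique X F G h : F \in flats -> G \in flats ->
    rk M F + #|X :\: F| <= h -> rk M G + #|X :\: G| <= h ->
    h < minn #|X| (mrank M) -> F = G.
Proof.
move=> FM GM hF hG hX; apply/eqP; apply: contraLR hX => neFG.
have := flats_cross FM GM neFG; rewrite -leqNgt.
have : #|X| <= #|F :&: G| + (#|X :\: F| + #|X :\: G|).
  have sX : X \subset (F :&: G) :|: ((X :\: F) :|: (X :\: G)).
    apply/fintype.subsetP => x xX; rewrite !inE xX.
    by case: (x \in F); case: (x \in G).
  apply: leq_trans (subset_leq_card sX) _.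
  by rewrite (leq_trans (leq_card_setU _ _)) // leq_add2l leq_card_setU.
move: hF hG; rk_lia.
Qed.

(** A flat attaining the rank exists by [cyclic_flat_cover] and is unique. A flat giving a larger
    value [h] would, by uniqueness, equal the one attaining the rank. The result is linear in the
    flats, which the later counting requires. *)
Lemma rk_eq_flats X h : h < minn #|X| (mrank M) ->
  (rk M X == h : nat) = \sum_(F in flats) (rk M F + #|X :\: F| == h).
Proof.
move=> hX; have rX F : rk M X <= rk M F + #|X :\: F| by apply: rk_setD.
have [/eqP rh|rh] := boolP (rk M X == h).
  have [|F FM rF] := @cyclic_flat_cover n M X; first by rewrite rh.
  rewrite (bigD1 F) //= rF rh eqxx big1 // => G /andP[GM neGF].
  apply/eqP; rewrite eqb0; apply: contraNN neGF => /eqP rG; apply/eqP.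
  by apply: (flats_cover_unique GM FM _ _ hX); rewrite ?rG ?rF ?rh.
rewrite big1 // => F FM; apply/eqP; rewrite eqb0; apply: contraNN rh => /eqP rF.
rewrite eqn_leq -{1}rF rX /= leqNgt; apply/negP => lt.
have [|G GM rG] := @cyclic_flat_cover n M X.
  exact: ltn_trans lt hX.
have FG : F = G.
  by apply: (flats_cover_unique FM GM _ _ hX); rewrite ?rF // rG ltnW.
by move: lt; rewrite -rG -FG rF ltnn.
Qed.

End SplitFlats.

(** * Cutting the hypersimplex *)

(** The hypersimplex. *)
Definition capped_simplex n k (x : 'I_n -> R) : Prop :=
  (forall i, 0 <= x i <= 1) /\ mass x setT = k%:R.

Lemma base_polytope_capped n (M : matroid n) x :
  in_base_polytope M x -> capped_simplex (mrank M) x.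
Proof.
move=> /base_polytopeP[x0 xS xT]; split=> // i; rewrite x0 /=.
have := xS [set i]; rewrite big_set1 => /le_trans; apply.
by rewrite -[leRHS]/(1%:R) ler_nat -(cards1 i) rk_card.
Qed.

Section CappedSimplex.
Variables (n k : nat) (x : 'I_n -> R).
Hypothesis xP : capped_simplex k x.
Implicit Types (S T F : {set 'I_n}).

Lemma capped_mass_card S : mass x S <= #|S|%:R.
Proof.
rewrite -sum1_card natr_sum ler_sum // => i _.
by have /andP[] := xP.1 i.
Qed.

Lemma capped_mass_mono S T : S \subset T -> mass x S <= mass x T.
Proof.
move=> sST; rewrite [leRHS](big_setID S) /= (setIidPr sST) lerDl.
by apply: sumr_ge0 => i _; have /andP[] := xP.1 i.
Qed.

Lemma capped_mass_le S : mass x S <= k%:R.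
Proof. by rewrite -xP.2 capped_mass_mono ?subsetT. Qed.

Lemma capped_massD S F : mass x S <= mass x F + #|S :\: F|%:R.
Proof.
by rewrite (big_setID F) /= lerD ?capped_mass_card // capped_mass_mono ?subsetIr.
Qed.

End CappedSimplex.

(** * Matroids of the hypersimplex cut by one inequality *)

Section CutMatroid.
Variables (n k r : nat).
Implicit Types (F B S T : {set 'I_n}).

(** When nonempty, the bases of the truncation to rank [k] of the direct sum of a uniform matroid of
    rank [minn r #|F|] on [F] and a free matroid on the complement. *)
Definition cut_bases F : {set {set 'I_n}} :=
  [set B : {set 'I_n} | (#|B| == k) && (#|F :&: B| <= r)%N].

(* Junk value: the rank 0 matroid when no set satisfies the constraints. *)
Definition cut_bases_total F : {set {set 'I_n}} :=
  if cut_bases F == set0 then [set set0] else cut_bases F.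

Lemma cut_bases_total_nonempty F : cut_bases_total F != set0.
Proof.
rewrite /cut_bases_total; case: ifPn => // _.
by apply/set0Pn; exists set0; rewrite inE.
Qed.

(** The delicate case has [x] outside [F] and the bound reached by [B1]. If no [y] could be found
    outside [F], then [B2] would have fewer elements than [B1] outside [F], hence more than [r]
    inside. *)
Lemma cut_bases_total_exchange F : basis_exchange (cut_bases_total F).
Proof.
rewrite /cut_bases_total; case: ifPn => _; apply/forall_inP => B1 B1M;
  apply/forall_inP => B2 B2M; apply/forall_inP => x; move: B1M B2M.
  by rewrite !inE => /eqP-> /eqP->; rewrite !inE.
rewrite !inE => /andP[/eqP c1 f1] /andP[/eqP c2 f2] /andP[xB2 xB1].
have [y yB yF] : exists2 y, y \in B2 :\: B1 &
    (#|F :&: B1| + (y \in F) <= r + (x \in F))%N.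
  have [allowed|] := boolP ((x \in F) || (#|F :&: B1| < r)%N).
    have [y yB] : exists y, y \in B2 :\: B1.
      apply/set0Pn; rewrite -card_gt0.
      have := cardsID B1 B2; have := cardsID B2 B1; rewrite setIC c1 c2.
      have : (0 < #|B1 :\: B2|)%N.
        by rewrite card_gt0; apply/set0Pn; exists x; rewrite inE xB2 xB1.
      by rk_lia.
    exists y => //; case/orP: allowed => [->|lt]; first by rewrite leq_add // leq_b1.
    by move: lt; case: (y \in F); case: (x \in F); rk_lia.
  rewrite negb_or -leqNgt => /andP[xF ge].
  have [y yD] : exists y, y \in (B2 :\: B1) :\: F.
    apply/set0Pn; apply/eqP => D0.
    have : (#|B2 :\: F| < #|B1 :\: F|)%N.
      apply: proper_card; rewrite fintype.properE; apply/andP; split.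
        apply/fintype.subsetP => z; rewrite !inE => /andP[zF zB2].
        have /setP/(_ z) := D0; rewrite !inE zF zB2 /= andbT.
        by move/negbFE.
      apply/negP => /fintype.subsetP/(_ x).
      by rewrite !inE xF xB1 (negPf xB2) => /(_ isT).
    have := cardsID F B1; have := cardsID F B2; rewrite ![_ :&: F]setIC c1 c2.
    by move: f2 ge; rk_lia.
  move: yD; rewrite inE => /andP[yF yD]; exists y => //.
  by rewrite (negPf yF) (negPf xF) !addn0.
apply/existsP; exists y; rewrite yB !inE.
move: yB; rewrite inE => /andP[yB1 yB2].
have cT := card_swapI setT xB1 yB1; have cF := card_swapI F xB1 yB1.
rewrite !setTI !in_setT in cT.
rewrite (addIn cT) c1 eqxx /= -(leq_add2r (x \in F)) cF.
exact: yF.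
Qed.

Definition cut_matroid F : matroid n :=
  Matroid (cut_bases_total_nonempty F) (cut_bases_total_exchange F).

(** List each set followed by its complement, and match the two lists position by position. *)
Lemma perm_of_card F F' : #|F| = #|F'| ->
  exists g : {perm 'I_n}, g @: F = F'.
Proof.
move=> cF.
pose s := enum F ++ enum (~: F); pose s' := enum F' ++ enum (~: F').
have mem_cat_setC (D : {set 'I_n}) x : x \in enum D ++ enum (~: D).
  by rewrite mem_cat !mem_enum inE orbN.
have uniq_cat_setC (D : {set 'I_n}) : uniq (enum D ++ enum (~: D)).
  rewrite cat_uniq !enum_uniq andbT /=; apply/hasPn => x.
  by rewrite !mem_enum inE.
have size_cat_setC (D : {set 'I_n}) : size (enum D ++ enum (~: D)) = n.
  by rewrite size_cat -!cardE cardsC card_ord.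
pose f x := nth x s' (index x s).
have f_inj : injective f.
  have ss' : size s = size s' by rewrite !size_cat_setC.
  have lt_index x : (index x s < size s')%N by rewrite -ss' index_mem mem_cat_setC.
  move=> x y; rewrite /f (set_nth_default y) // => /eqP.
  rewrite nth_uniq ?uniq_cat_setC // => /eqP ixy.
  by rewrite -[LHS](nth_index x (mem_cat_setC F x)) -/s ixy nth_index ?mem_cat_setC.
exists (perm f_inj); apply/eqP; rewrite eqEcard card_imset; last exact: perm_inj.
rewrite cF leqnn andbT; apply/fintype.subsetP => _ /imsetP[x xF ->].
rewrite permE /f nth_cat index_cat mem_enum xF.
have lt : (index x (enum F) < size (enum F'))%N.
  by rewrite -cardE -cF cardE index_mem mem_enum.
by rewrite lt -mem_enum mem_nth.
Qed.

Lemma cut_matroid_isom F F' : #|F| = #|F'| ->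
  misom (cut_matroid F) (cut_matroid F').
Proof.
move=> /perm_of_card[g <-]; exists g => /=.
have injg : injective (fun B : {set 'I_n} => g @: B).
  by apply: imset_inj; exact: perm_inj.
have cut_g : cut_bases (g @: F) = [set g @: B | B : {set 'I_n} in cut_bases F].
  have cutE (C : {set 'I_n}) : (g @: C \in cut_bases (g @: F)) = (C \in cut_bases F).
    rewrite !inE -imsetI; last by move=> i j _ _; exact: perm_inj.
    by rewrite !(card_imset _ (@perm_inj _ g)).
  apply/setP => B; have -> : B = g @: (g^-1%g @: B).
    rewrite -imset_comp -[LHS]imset_id; apply: eq_imset => i /=.
    by rewrite permKV.
  by rewrite cutE mem_imset.
rewrite /cut_bases_total cut_g imset_eq0.
by case: ifP => _ //; rewrite imset_set1 imset0.
Qed.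

Lemma cut_basesE F : cut_bases F != set0 -> bases (cut_matroid F) = cut_bases F.
Proof. by move=> cut0; rewrite /= /cut_bases_total (negPf cut0). Qed.

Lemma cut_mrank F : cut_bases F != set0 -> mrank (cut_matroid F) = k.
Proof.
move=> cut0; have /set0Pn[B] := cut0; rewrite -cut_basesE // => BM.
by rewrite (mrankE BM); move: BM; rewrite cut_basesE // inE => /andP[/eqP].
Qed.

Lemma cut_polytopeP F x : cut_bases F != set0 ->
  in_base_polytope (cut_matroid F) x <-> capped_simplex k x /\ mass x F <= r%:R.
Proof.
move=> cut0; have basesE := cut_basesE cut0.
split=> [xM|[xP xF]].
  split; first by rewrite -(cut_mrank cut0); apply: base_polytope_capped.
  have /base_polytopeP[_ xS _] := xM; rewrite (le_trans (xS F)) // ler_nat.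
  have [C CM <-] := rk_attained (cut_matroid F) F.
  by move: CM; rewrite basesE inE => /andP[].
have /set0Pn[B] := cut0; rewrite inE => /andP[/eqP cB cFB].
have kF : (k <= r + #|~: F|)%N.
  rewrite -cB -(cardsID F B) setIC leq_add // subset_leq_card //.
  by rewrite setDE subsetIr.
have kn : (k <= n)%N by rewrite -cB -[leqRHS]card_ord max_card.
(* The rank function of the cut matroid; each of its three terms bounds the mass of [S] under the
   assumptions on [x]. *)
pose rho S := minn #|S| (minn k (r + #|S :\: F|)).
have rhoT : rho setT = k.
  by rewrite /rho cardsT card_ord setTD; move: kF kn; clear; lia.
apply: (@base_point_in_polytope n rho).
- move=> S T; rewrite /rho.
  have := cardsUI S T; have := cardsUI (S :\: F) (T :\: F).
  rewrite -setDUl -setDIl.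
  have := cardsID F S; have := cardsID F T; have := cardsID F (S :|: T).
  have := cardsID F (S :&: T).
  have : (#|S :&: T :&: F| <= #|S :&: F|)%N.
    by rewrite subset_leq_card // setSI // subsetIl.
  have : (#|S :&: T :&: F| <= #|T :&: F|)%N.
    by rewrite subset_leq_card // setSI // subsetIr.
  have : (#|(S :&: T) :\: F| <= #|S :\: F|)%N.
    by rewrite subset_leq_card // setSD // subsetIl.
  have : (#|(S :&: T) :\: F| <= #|T :\: F|)%N.
    by rewrite subset_leq_card // setSD // subsetIr.
  rk_lia.
- by move=> i; rewrite /rho cards1 geq_minl.
- move=> C cC rC; rewrite basesE inE cC rhoT eqxx /=.
  by apply: leq_trans (rC F) _; rewrite /rho setDv cards0 addn0; clear; lia.
- split=> [i|S|]; first by have /andP[] := xP.1 i.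
    rewrite /rho /minn; case: ifP => _; first exact: capped_mass_card xP S.
    case: ifP => _; first exact: capped_mass_le xP S.
    by rewrite natrD (le_trans (capped_massD xP S F)) // lerD2r.
  by rewrite xP.2 rhoT.
Qed.

End CutMatroid.

(** * The polytope relation of an elementary split matroid *)

Section SplitRelation.
Variables (n : nat) (M : matroid n).
Implicit Types (F G S : {set 'I_n}).

Local Notation k := (mrank M).
Local Notation flats := (proper_cyclic_flats M).
(** With [F] empty the constraint is vacuous, so this is the uniform matroid of rank [k]. *)
Local Notation uniform := (@cut_matroid n k 0 set0).
Local Notation cut F := (cut_matroid k (rk M F) F).

Lemma cut_bases_neq0 F : cut_bases k (rk M F) F != set0.
Proof.
have /set0Pn[B BM] := bases_nonempty M; apply/set0Pn; exists B.
by rewrite inE (mrankE BM) eqxx rk_ge.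
Qed.

Lemma uniform_bases_neq0 : cut_bases k 0 (set0 : {set 'I_n}) != set0.
Proof. by have := cut_bases_neq0 set0; rewrite rk0. Qed.

Lemma uniform_polytopeP x : in_base_polytope uniform x <-> capped_simplex k x.
Proof.
rewrite cut_polytopeP ?uniform_bases_neq0 // big_set0 lexx.
by split=> [[]|].
Qed.

(** The inequality of a set [S] that is independent or spanning comes from the hypersimplex; that of
    any other [S] follows from the one of a flat given by [cyclic_flat_cover]. *)
Lemma flats_polytopeP x : in_base_polytope M x <->
  capped_simplex k x /\ {in flats, forall F, mass x F <= (rk M F)%:R}.
Proof.
split=> [xM|[xP xF]].
  split; first exact: base_polytope_capped.
  by have /base_polytopeP[_ xS _] := xM => F _; apply: xS.
apply/base_polytopeP; split=> [i|S|]; last exact: xP.2.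
  by have /andP[] := xP.1 i.
have [ltS|] := boolP (rk M S < minn #|S| k)%N.
  have [F FM <-] := cyclic_flat_cover ltS.
  by rewrite natrD (le_trans (capped_massD xP S F)) // lerD2r xF.
rewrite -leqNgt geq_min => /orP[] le.
  by rewrite (le_trans (capped_mass_card xP S)) // ler_nat.
by rewrite (le_trans (capped_mass_le xP S)) // ler_nat.
Qed.

Hypothesis splitM : elementary_split M.

(** The masses of [F :|: G] and [F :&: G] are at most [k] and [#|F :&: G|], so by [flats_cross] the
    masses of [F] and [G] add up to at most the sum of their ranks. *)
Lemma flats_violated_once (x : 'I_n -> R) F G : capped_simplex k x -> F \in flats ->
    G \in flats -> F != G -> (rk M F)%:R < mass x F ->
  mass x G <= (rk M G)%:R.
Proof.
move=> xP FM GM neFG vF.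
have massUI : mass x (F :|: G) + mass x (F :&: G) = mass x F + mass x G.
  rewrite (big_setID F (A := F :|: G)) /= setUK setDUl setDv set0U.
  by rewrite (big_setID F (A := G)) /= (setIC G F) -addrA [_ + mass x (F :&: G)]addrC.
have := flats_cross splitM FM GM neFG; rewrite -(ler_nat R) !natrD.
have := capped_mass_le xP (F :|: G); have := capped_mass_card xP (F :&: G).
move: vF massUI; clear; lra.
Qed.

(* P(M) is obtained from the hypersimplex by cutting off, for each proper
   cyclic flat F, the part where x(F) > rk F, and these parts are disjoint. *)
Lemma split_relation x :
  ind_base_polytope M x - ind_base_polytope uniform x +
  \sum_(F in flats) (ind_base_polytope uniform x - ind_base_polytope (cut F) x)
  = 0.
Proof.
rewrite /ind_base_polytope.
have cutP F := cut_polytopeP x (cut_bases_neq0 F).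
have [xP|xNP] := pselect (capped_simplex k x); last first.
  rewrite !asboolF ?subrr ?add0r => [|/uniform_polytopeP //|/flats_polytopeP[] //].
  by rewrite big1 // => F _; rewrite asboolF ?subrr // => /cutP[].
rewrite [asbool (in_base_polytope uniform x)]asboolT; last exact/uniform_polytopeP.
have [/forall_inP xF|] := boolP [forall F in flats, mass x F <= (rk M F)%:R].
  rewrite asboolT; last exact/flats_polytopeP.
  rewrite subrr add0r big1 // => F FM; rewrite asboolT ?subrr //.
  by apply/cutP; split=> //; apply: xF.
rewrite negb_forall_in => /exists_inP[F FM vF].
rewrite asboolF; last first.
  by move=> /flats_polytopeP[_ /(_ F FM)] le; rewrite le in vF.
rewrite (bigD1 F) //= asboolF; last by move=> /cutP[_ le]; rewrite le in vF.
rewrite big1 => [|G /andP[GM neGF]]; first by rewrite !sub0r subr0 addr0 addNr.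
rewrite asboolT ?subrr //; apply/cutP; split=> //.
apply: flats_violated_once FM GM _ _ => //; first by rewrite eq_sym.
by rewrite ltNge.
Qed.

Lemma split_value (A : zmodType) (f : forall m, matroid m -> A) :
    valuative_invariant f ->
  f n M = f n uniform - \sum_(F in flats) (f n uniform - f n (cut F)).
Proof.
move=> [fval _].
have kn : (k <= n)%N by rewrite (leq_trans (rk_card _ _)) // cardsT card_ord.
(* The terms of [split_relation], with the uniform matroid repeated once per flat. *)
pose s : seq (int * matroid n) := [:: (1, M); (-1, uniform)] ++
  [seq (1, uniform) | F <- enum flats] ++ [seq (-1, cut F) | F <- enum flats].
have sum_s (B : zmodType) (g : matroid n -> B) : \sum_(p <- s) g p.2 *~ p.1 =
    g M - g uniform + \sum_(F in flats) (g uniform - g (cut F)).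
  rewrite /s !big_cat !big_cons !big_nil !big_map !big_enum /=.
  rewrite mulr1z mulrN1z addr0; congr (_ + _); rewrite -big_split /=.
  by apply: eq_bigr => F _; rewrite mulr1z mulrN1z.
have /(_ _ _)/eqP := fval n k kn s; rewrite sum_s addrAC subr_eq0 => fs.
apply/eqP; rewrite -subr_eq opprK; apply: fs => [|x].
  rewrite /s !all_cat /= !all_map eqxx cut_mrank ?uniform_bases_neq0 ?eqxx //=.
  apply/andP; split; apply/allP => F _ /=.
    by rewrite cut_mrank ?uniform_bases_neq0.
  by rewrite cut_mrank ?cut_bases_neq0.
transitivity (\sum_(p <- s) ind_base_polytope p.2 x *~ p.1); last first.
  by rewrite (sum_s _ (fun N => ind_base_polytope N x)) split_relation.
by apply: eq_bigr => p _; rewrite mulrzz mulrC.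
Qed.

End SplitRelation.

(** * Factorization through the Tutte polynomial *)

Section RankSize.
Variable n : nat.
Implicit Types (M : matroid n) (r h : nat).

Definition rank_size M r h : nat :=
  #|[set X : {set 'I_n} | (rk M X == r) && (#|X| == h)]|.

Definition flat_count M r h : nat :=
  #|[set F in proper_cyclic_flats M | (rk M F == r) && (#|F| == h)]|.

(** A standard set of size [h] when [h <= n], representing all such sets up to permutation. *)
Definition segment h : {set 'I_n} := [set i : 'I_n | (i < h)%N].

(* Number of sets X of size h for which a flat F of rank r' and size h' gives
   the bound rk X <= r' + |X :\: F| = r. *)
Definition incidence r' h' r h : nat :=
  #|[set X : {set 'I_n} | (r' + #|X :\: segment h'| == r)%N && (#|X| == h)]|.

(** The coefficient of [x^a y^b] in [p(x + 1, y + 1)], with [y] the outer variable. *)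
Definition shifted_coef a b (p : {poly {poly int}}) : int :=
  ((p \Po ('X + 1))`_b \Po ('X + 1))`_a.

Lemma shifted_coefB a b : zmod_morphism (shifted_coef a b).
Proof.
by move=> p q; rewrite /shifted_coef !(rmorphB, raddfB) /= coefB rmorphB coefB.
Qed.

Lemma comp_poly1 (S : comNzRingType) (p : {poly S}) : 1 \Po p = 1.
Proof. by rewrite -polyC1 comp_polyC. Qed.

(** After the shift, [X] contributes the monomial with exponents [mrank M - rk M X] and
    [#|X| - rk M X]. The two bounds on [r] make the subtractions exact, so the exponents determine
    rank and size. *)
Lemma tutte_shifted_coef M r h : (r <= h)%N -> (r <= mrank M)%N ->
  shifted_coef (mrank M - r) (h - r) (tutte M) = (rank_size M r h)%:R.
Proof.
move=> rh rk_r; rewrite /rank_size /shifted_coef /tutte !rmorph_sum /=.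
rewrite coef_sum rmorph_sum coef_sum -sum1dep_card natr_sum [RHS]big_mkcond /=.
apply: eq_bigr => X _.
rewrite rmorphM !rmorphXn !rmorphB /= comp_polyC comp_polyX !comp_poly1 addrK.
rewrite -[X in (X - 1) ^+ _]/('X%:P) -polyC1 -polyCB -polyC_exp coefCM coefXn.
have kX := rk_mrank M X; have cX := rk_card M X.
have -> : (rk M X == r) && (#|X| == h) =
    (h - r == #|X| - rk M X)%N && (mrank M - r == mrank M - rk M X)%N.
  move: rh rk_r kX cX; rk_lia.
case: (h - r == _)%N => /=; last by rewrite mulr0 rmorph0 coef0.
rewrite mulr1 rmorphXn rmorphB /= comp_polyX comp_poly1 addrK coefXn.
by case: (_ == _).
Qed.

Lemma card_segment h : (h <= n)%N -> #|segment h| = h.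
Proof.
move=> hn; have -> : segment h = widen_ord hn @: [set: 'I_h].
  apply/setP => i; rewrite inE; apply/idP/imsetP => [ih|[j _ ->]]; last first.
    exact: (ltn_ord j).
  by exists (Ordinal ih) => //; apply: val_inj.
rewrite card_imset ?cardsT ?card_ord // => i j /(congr1 val) /=.
exact: val_inj.
Qed.

Lemma incidence_flat r' (F : {set 'I_n}) r h : incidence r' #|F| r h =
  #|[set X : {set 'I_n} | (r' + #|X :\: F| == r)%N && (#|X| == h)]|.
Proof.
have Fn : (#|F| <= n)%N by rewrite -[leqRHS]card_ord max_card.
have [g gF] := perm_of_card (card_segment Fn).
have injg := @perm_inj _ g.
rewrite /incidence -(card_imset _ (imset_inj injg)); apply: eq_card => X.
have -> : X = g @: (g^-1%g @: X).
  by rewrite -imset_comp -[LHS]imset_id; apply: eq_imset => i /=; rewrite permKV.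
rewrite mem_imset; last exact: imset_inj.
rewrite !inE -[in RHS]gF !cardsD -imsetI; last by move=> i j _ _; exact: injg.
by rewrite !(card_imset _ injg).
Qed.

Lemma incidence_diag r h : (h <= n)%N -> incidence r h r h = 1%N.
Proof.
move=> hn; rewrite /incidence -(cards1 (segment h)); apply: eq_card => X.
have addr_id m : (r + m == r)%N = (m == 0)%N by rewrite -{2}[r]addn0 eqn_add2l.
rewrite !inE addr_id cards_eq0 setD_eq0.
rewrite eqEcard card_segment //; case: (boolP (X \subset _)) => //= sX.
by have := subset_leq_card sX; rewrite card_segment // eqn_leq => ->.
Qed.

(** If [X] lies in the segment, then [r = r'] and [h < h']; otherwise [r' < r]. The weight encodes
    this lexicographic order, since [n - h] is less than [n.+1]. *)
Lemma incidence_triangular r' h' r h : (h <= n)%N -> (h' <= n)%N ->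
  incidence r' h' r h != 0%N -> (r', h') != (r, h) ->
  (r' * n.+1 + (n - h') < r * n.+1 + (n - h))%N.
Proof.
move=> hn h'n; rewrite cards_eq0 => /set0Pn[X]; rewrite inE => /andP[/eqP rX /eqP cX].
have le_h : (h <= h' + #|X :\: segment h'|)%N.
  rewrite -{1}cX -(cardsID (segment h') X) leq_add2r -[leqRHS](card_segment h'n).
  by rewrite subset_leq_card // subsetIr.
rewrite xpair_eqE negb_and; move: rX le_h; case: #|_| => [|m] rX le_h ne.
  move: ne le_h h'n; rewrite -rX addn0 eqxx /=; clear; move=> ne le_h h'n.
  have : (h < h')%N by rewrite ltn_neqAle eq_sym ne; move: le_h; clear; lia.
  by rewrite ltn_add2l; move: h'n; clear; lia.
rewrite -rX; move: hn h'n; clear; nia.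
Qed.

End RankSize.

(** * Invariants that factor through the Tutte polynomial *)

Section Universality.
Variables (n k : nat).

Definition factors (A : zmodType) (g : matroid n -> A) : Prop :=
  exists2 phi : {poly {poly int}} -> A, zmod_morphism phi &
    forall M, elementary_split M -> mrank M = k -> g M = phi (tutte M).

Lemma factors_ext (A : zmodType) (g g' : matroid n -> A) : factors g' ->
    (forall M, elementary_split M -> mrank M = k -> g M = g' M) ->
  factors g.
Proof.
move=> [phi phiB phiE] gg'; exists phi => // M splitM rM.
by rewrite gg' ?phiE.
Qed.

Lemma factors0 (A : zmodType) : factors (fun _ => 0 : A).
Proof. by exists (fun _ => 0) => // p q; rewrite subrr. Qed.

Lemma factorsB (A : zmodType) (g g' : matroid n -> A) :
  factors g -> factors g' -> factors (fun M => g M - g' M).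
Proof.
move=> [phi phiB phiE] [psi psiB psiE]; exists (fun p => phi p - psi p).
  by move=> p q; rewrite phiB psiB !opprB addrACA [RHS]addrACA [- psi p + _]addrC.
by move=> M splitM rM; rewrite phiE ?psiE.
Qed.

Lemma factorsD (A : zmodType) (g g' : matroid n -> A) :
  factors g -> factors g' -> factors (fun M => g M + g' M).
Proof.
move=> gP g'P; apply: factors_ext (factorsB gP (factorsB (factors0 A) g'P)) _.
by move=> M _ _; rewrite sub0r opprK.
Qed.

Lemma factors_sum (A : zmodType) (I : Type) (s : seq I)
    (g : I -> matroid n -> A) :
  (forall i, factors (g i)) -> factors (fun M => \sum_(i <- s) g i M).
Proof.
move=> gP; elim: s => [|i s IHs].
  by apply: factors_ext (factors0 A) _ => M _ _; rewrite big_nil.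
apply: factors_ext (factorsD (gP i) IHs) _ => M _ _.
by rewrite big_cons.
Qed.

Lemma factors_scale (A : zmodType) (g : matroid n -> int) (a : A) :
  factors g -> factors (fun M => a *~ g M).
Proof.
move=> [phi phiB phiE]; exists (fun p => a *~ phi p).
  by move=> p q; rewrite phiB mulrzBr.
by move=> M splitM rM; rewrite phiE.
Qed.

Lemma factors_rank_size r h : (r <= h)%N -> (r <= k)%N ->
  factors (fun M => (rank_size M r h)%:R : int).
Proof.
move=> rh rk_r; exists (shifted_coef (k - r) (h - r)).
  exact: shifted_coefB.
by move=> M _ rM; rewrite -rM tutte_shifted_coef ?rM.
Qed.

Lemma sum_flats (A : zmodType) (M : matroid n) (c : nat -> nat -> A) :
  \sum_(F in proper_cyclic_flats M) c (rk M F) #|F| =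
  \sum_(i < n.+1) \sum_(j < n.+1) c i j *~ (flat_count M i j)%:R.
Proof.
pose P F (i j : 'I_n.+1) := (rk M F == i) && (#|F| == j).
transitivity (\sum_(i < n.+1) \sum_(j < n.+1)
  \sum_(F in proper_cyclic_flats M) c i j *~ (P F i j)%:R); last first.
  apply: eq_bigr => i _; apply: eq_bigr => j _; rewrite -mulrz_sumr.
  congr (_ *~ _); rewrite -natr_sum; congr _%:R.
  by rewrite /flat_count -sum1dep_card big_mkcondr; apply: eq_bigr => F _;
    rewrite /P; case: (_ && _).
under [RHS]eq_bigr do rewrite exchange_big.
rewrite exchange_big; apply: eq_bigr => F _ /=.
have cF : (#|F| < n.+1)%N by rewrite ltnS -[leqRHS]card_ord max_card.
have rF : (rk M F < n.+1)%N := leq_ltn_trans (rk_card M F) cF.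
rewrite (bigD1 (Ordinal rF)) //= (bigD1 (Ordinal cF)) //= /P /= !eqxx mulr1z.
rewrite [X in _ = _ + X + _]big1 => [|j ne]; last first.
  by rewrite [#|F| == j]eq_sym (negPf (ne : (j : nat) != #|F|)).
rewrite [X in _ = _ + X]big1 ?addr0 // => i ne; rewrite big1 // => j _.
by rewrite [rk M F == i]eq_sym (negPf (ne : (i : nat) != rk M F)).
Qed.

(** Sum [rk_eq_flats] over the sets [X] of size [h] and exchange the sums. *)
Lemma rank_size_flats (M : matroid n) r h : elementary_split M -> (r < minn h (mrank M))%N ->
  rank_size M r h =
  (\sum_(F in proper_cyclic_flats M) incidence n (rk M F) #|F| r h)%N.
Proof.
move=> splitM rhk; rewrite /rank_size -sum1dep_card big_mkcond /=.
under [RHS]eq_bigr => F _.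
  rewrite incidence_flat -sum1dep_card big_mkcond /=. over.
rewrite exchange_big; apply: eq_bigr => X _ /=.
have [cX|_] := eqVneq #|X| h; last by rewrite andbF big1 // => F _; rewrite andbF.
rewrite andbT; have := @rk_eq_flats n M splitM X r; rewrite cX => /(_ rhk) rkE.
transitivity (rk M X == r : nat); first by case: (_ == _).
by rewrite rkE; apply: eq_bigr => F _; rewrite andbT; case: (_ == _).
Qed.

(* The pairs (r, h) are ordered by increasing r, then decreasing h; for this
   order the incidence numbers are unitriangular. *)
Lemma factors_flat_count r h : (h <= n)%N ->
  factors (fun M => (flat_count M r h)%:R : int).
Proof.
have [m] := ubnP (r * n.+1 + (n - h)); elim: m r h => // m IHm r h lem hn.
(* Outside this range no proper cyclic flat has rank [r] and size [h]. *)
have [rhk|rhk] := boolP (r < minn h k)%N; last first.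
  apply: factors_ext (factors0 _) _ => M _ rM; apply/eqP.
  rewrite pnatr_eq0 cards_eq0 -subset0; apply/fintype.subsetP => F.
  rewrite !inE leq_min rM => /andP[/and3P[lt _ _] /andP[/eqP rF /eqP cF]].
  by rewrite leq_min -rF -cF lt in rhk.
move: (rhk); rewrite leq_min => /andP[rh rk_r].
pose c i j : int := (incidence n i j r h)%:R.
(* The off-diagonal terms of the equation for [rank_size M r h]: each has coefficient zero or a flat
   count covered by the induction hypothesis. *)
pose g (i j : 'I_n.+1) (M : matroid n) : int :=
  if ((i : nat, j : nat) == (r, h)) then 0 else c i j *~ (flat_count M i j)%:R.
have gP i j : factors (g i j).
  rewrite /g; case: eqVneq => [_|ne]; first exact: factors0.
  have [inc0|inc] := eqVneq (incidence n i j r h) 0%N.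
    by apply: factors_ext (factors0 _) _ => M _ _; rewrite /c inc0 mul0rz.
  have jn : (j <= n)%N by rewrite -ltnS.
  apply: factors_scale; apply: IHm => //.
  exact: leq_trans (incidence_triangular hn jn inc ne) lem.
apply: factors_ext (factorsB (factors_rank_size (ltnW rh) (ltnW rk_r))
  (factors_sum (index_enum 'I_n.+1) (fun i =>
    factors_sum (index_enum 'I_n.+1) (gP i)))) _ => M splitM rM.
rewrite rank_size_flats ?rM // natr_sum (sum_flats M c) -sumrB.
have rn : (r < n.+1)%N by rewrite ltnS (leq_trans (ltnW rh)).
have hn' : (h < n.+1)%N by [].
rewrite (bigD1 (Ordinal rn)) //= -sumrB (bigD1 (Ordinal hn')) //=.
rewrite [X in _ = _ + X + _]big1 => [|j ne]; last first.
  by rewrite /g xpair_eqE (negPf (ne : (j : nat) != h)) andbF subrr.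
rewrite [X in _ = _ + X]big1 => [|i ne]; last first.
  rewrite -sumrB big1 // => j _.
  by rewrite /g xpair_eqE (negPf (ne : (i : nat) != r)) subrr.
by rewrite /g eqxx subr0 /c incidence_diag // !addr0 intz.
Qed.

(** The ground set is the only set of size [n] and has rank [k], so the number 1 is itself a shifted
    coefficient of the Tutte polynomial. *)
Lemma factors_const (A : zmodType) (a : A) : (k <= n)%N -> factors (fun _ => a).
Proof.
move=> kn; apply: factors_ext (factors_scale a (factors_rank_size kn (leqnn k))) _.
move=> M _ rM; rewrite (_ : rank_size M k n = 1%N) //.
rewrite /rank_size -(cards1 [set: 'I_n]); apply: eq_card => X; rewrite !inE.
rewrite eqEcard subsetT cardsT card_ord /=; case: (ltngtP #|X| n) => [|lt|cX].
- by rewrite andbF.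
- by rewrite ltnNge -[leqRHS]card_ord max_card in lt.
have -> : X = setT by apply/eqP; rewrite eqEcard subsetT cardsT card_ord cX /=.
by rewrite -rM eqxx.
Qed.

End Universality.

Theorem theoremB :
  valuative_invariant tutte /\
  valuatively_universal_within tutte elementary_split.
Proof.
split; first by split=> [n k _|]; [exact: tutte_valuative | exact: tutte_isom].
move=> A f fP n k kn.
(* The contribution of a flat of rank [r] and size [h] to [split_value]; by invariance it may be
   computed on a segment. *)
pose d r h := f n (@cut_matroid n k 0 set0) -
  f n (cut_matroid k r (segment n h)).
have [phi phiB phiE] : factors k (f n).
  apply: factors_ext (factorsB (factors_const (f n (@cut_matroid n k 0 set0)) kn)
    (factors_sum (index_enum 'I_n.+1) (fun i => factors_sum (index_enum 'I_n.+1)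
     (fun j => factors_scale (d i j) (factors_flat_count k i (ltn_ord j : (j <= n)%N)))))) _.
  move=> M splitM rM; rewrite (split_value splitM fP) rM -sum_flats.
  congr (_ - _); apply: eq_bigr => F FM; congr (_ - _).
  apply: fP.2; apply: cut_matroid_isom; rewrite card_segment //.
  by rewrite -[leqRHS]card_ord max_card.
pose phi_additive := GRing.isZmodMorphism.Build _ _ phi phiB.
pose h : {additive {poly {poly int}} -> A} := HB.pack phi phi_additive.
exists h => M splitM rM.
exact: phiE.
Qed.
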